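(* Let $\varepsilon_1,\varepsilon_2>0$, $\delta_1,\delta_2\in(0,1)$, let $\Delta_0$ be a positive integer, $d_{max}>1$, $\beta\ge 0$, $C_{lb},C_{ub}\ge 0$, $b_{min}\in[1/2,1]$ and $b_{max}\in[1,\infty)$. Then the algorithm $\texttt{MAD2R}(\mathcal{S},(\varepsilon_1,\delta_1),(\varepsilon_2,\delta_2),\Delta_0,d_{max},\beta,C_{lb},C_{ub},b_{min},b_{max})$, which outputs the set $U_1\cup U_2$, is $(\varepsilon_1+\varepsilon_2,\delta_1+\delta_2)$-differentially private.
   Context: Setting: $\Sigma$ is a possibly infinite universe of items; a dataset is $\mathcal{S}=\{(u,S_u)\}_{u\in[n]}$ with finite $S_u\subseteq\Sigma$, and $\mathcal{U}=\bigcup_uS_u$. Datasets are neighboring if one is obtained from the other by adding one user's set. $\mathcal{M}$ is $(\varepsilon,\delta)$-DP if for all neighboring $\mathcal{S},\mathcal{S}'$ and all output sets $\mathcal{O}$, $\Pr(\mathcal{M}(\mathcal{S})\in\mathcal{O})\le e^\varepsilon\Pr(\mathcal{M}(\mathcal{S}')\in\mathcal{O})+\delta$. $\Phi$ is the standard Gaussian CDF. Subroutine $\texttt{UserWeights}(S_u,b,b_{min},b_{max})$ (with $d=|S_u|$, $b$ a real-valued bias function on items): set $w_b(i)=0$ for $i\notin S_u$; let $S_{biased}=\{i\in S_u:b(i)<1\}$, $S_{unbiased}=S_u\setminus S_{biased}$; set $w_b(i)=\max\{b_{min},b(i)\}/\sqrt d$ for $i\in S_{biased}$; set $w_b(i)=\min\{b_{max}/\sqrt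 d,\sqrt{(1-\sum_{j\in S_{biased}}w_b(j)^2)/|S_{unbiased}|}\}$ for $i\in S_{unbiased}$; then while $\sum_{i\in S_u}w_b(i)^2<1$: let $S_{small}=\{i\in S_u:w_b(i)<1/\sqrt d\}$, $C=\min\{\frac{b_{max}/\sqrt d}{\max_{i\in S_{small}}w_b(i)},\sqrt{1+\frac{1-\sum_{i\in S_u}w_b(i)^2}{\sum_{i\in S_{small}}w_b(i)^2}}\}$, and multiply $w_b(i)$ by $C$ for all $i\in S_{small}$. Return $w_b$. Weighting algorithm $\texttt{MAD}(\mathcal{S},\tau,d_{max},b,b_{min},b_{max})$ (with $\tau\ge0$): let $\alpha=b_{min}-\frac{1}{2\sqrt{d_{max}}}$ and $I_{adapt}=\{u:\lceil 1/b_{min}^2\rceil\le|S_u|\le d_{max}\}$. For $i\in\mathcal{U}$: $w_{init}(i)=\sum_{u\in I_{adapt}:i\in S_u}1/|S_u|$; $r(i)=\max\{0,(w_{init}(i)-\tau)/w_{init}(i)\}$ (and $r(i)=0$ if $w_{init}(i)=0$); $w_{trunc}(i)=\min\{w_{init}(i),\tau\}$. For $u\in I_{adapt}$: $e_u=\frac{1}{|S_u|}\sum_{i\in S_u}r(i)$, and $w_{reroute}(i)=\sum_{u\in I_{adapt}:i\in S_u}\alpha e_u/d_{max}$. For every user let $w_b^u=\texttt{UserWeights}(S_u,b,b_{min},b_{max})$. Output $w(i)=w_{trunc}(i)+w_{reroute}(i)+\sum_{u\in I_{adapt}:i\in S_u}(w_b^u(i)-1/|S_u|)+\sum_{u\notin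 I_{adapt}:i\in S_u}w_b^u(i)$. Algorithm $\texttt{MAD2R}$: (1) replace each $S_u$ with $|S_u|>\Delta_0$ by a uniformly random subset of $\Delta_0$ items. (2) For $r\in\{1,2\}$ choose $\sigma_r>0$ with $\Phi\left(\frac{1}{2\sigma_r}-\varepsilon_r\sigma_r\right)-e^{\varepsilon_r}\Phi\left(-\frac{1}{2\sigma_r}-\varepsilon_r\sigma_r\right)\le\delta_r/2$. Round 1: $\rho_1=\max_{t\in[\Delta_0]}\left(\frac1{\sqrt t}+\sigma_1\Phi^{-1}((1-\delta_1/2)^{1/t})\right)$; $w_1=\texttt{MAD}(\mathcal{S},\rho_1+\beta\sigma_1,d_{max},b\equiv1,1,1)$; $\tilde w_1=w_1+$ independent $\mathcal{N}(0,\sigma_1^2)$ noise on each item of $\mathcal{U}$; $U_1=\{i\in\mathcal{U}:\tilde w_1(i)\ge\rho_1\}$. Round 2: $\rho_2=\max_{t\in[\Delta_0]}\left(\frac{b_{max}}{\sqrt t}+\sigma_2\Phi^{-1}((1-\delta_2/2)^{1/t})\right)$; $\tilde w_{lb}=\max\{0,\tilde w_1-C_{lb}\sigma_1\}$, $\tilde w_{ub}=\tilde w_1+C_{ub}\sigma_1$; $U_{low}=\{i\in\mathcal{U}:\tilde w_{ub}(i)<\rho_2\}$; replace every $S_u$ by $S_u\setminus(U_1\cup U_{low})$; set biases $b(i)=\min\{1,\rho_2/\tilde w_{lb}(i)\}$ (equal to $1$ when $\tilde w_{lb}(i)=0$); $w_2=\texttt{MAD}(\mathcal{S},\rho_2+\beta\sigma_2,d_{max},b,b_{min},b_{max})$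 on the modified sets; $\tilde w_2=w_2+$ independent $\mathcal{N}(0,\sigma_2^2)$ noise; $U_2=\{i:\tilde w_2(i)\ge\rho_2\}$. Output $U_1\cup U_2$. *)

(* Defs.v *)
From HB Require Import structures.
From mathcomp Require Import all_boot all_order all_algebra finmap.
From mathcomp Require Import all_classical all_reals all_analysis.

Set Implicit Arguments.
Unset Strict Implicit.
Unset Printing Implicit Defensive.

Import Order.TTheory GRing.Theory Num.Theory.

Local Open Scope fset_scope.
Local Open Scope ring_scope.

(* [normal_prob m s] is parameterized by the standard deviation [s]. *)
Definition Phi {R : realType} (x : R) : R :=
  fine (normal_prob (0 : R) 1 `]-oo, x]%classic).

(* Only used for p in ]0, 1[, where the preimage is a singleton. *)
Definition Phi_inv {R : realType} (p : R) : R :=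
  xget 0 [set x : R | Phi x = p]%classic.

Section iid.
Context {d : measure_display} {T : measurableType d} {R : realType}.

Definition tcons n (z : T * n.-tuple T) : n.+1.-tuple T :=
  [the n.+1.-tuple T of z.1 :: z.2].

Fact measurable_tcons n : measurable_fun [set: T * n.-tuple T]%classic (@tcons n).
Proof. exact: measurable_cons. Qed.

HB.instance Definition _ n :=
  isMeasurableFun.Build _ _ (T * n.-tuple T)%type (n.+1.-tuple T)
    (@tcons n) (@measurable_tcons n).

(* Joint law of n independent draws from [P]. *)
Fixpoint iid (P : probability T R) (n : nat) : probability (n.-tuple T) R :=
  match n with
  | 0%N => \d_([tuple] : 0.-tuple T)
  | m.+1 => distribution (P \x iid P m)%E (@tcons m)
  end.

End iid.

(** [while c f x]: value of the program variable, initialized to [x], on exit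
    from the loop "while c do f"; by convention [x] if the loop never exits. *)
Definition while {T : Type} (c : T -> bool) (f : T -> T) (x : T) : T :=
  if pselect (exists n, ~~ c (iter n f x)) is left halts
  then iter (ex_minn halts) f x else x.

(** Datasets: the u-th entry of the sequence is the item set of user u. *)

Section dataset.
Context {Sigma : choiceType} {R : realType}.

Definition dataset := seq {fset Sigma}.

Definition universe (S : dataset) : {fset Sigma} := \bigcup_(A <- S) A.

Definition adds_one_user (S S' : dataset) : Prop :=
  exists (S1 S2 : dataset) (A : {fset Sigma}),
    S = S1 ++ S2 /\ S' = S1 ++ A :: S2.

Definition neighboring (S S' : dataset) : Prop :=
  adds_one_user S S' \/ adds_one_user S' S.

(* A mechanism with outputs in [Out]; [M S O] is the probability that the
   output on [S] lies in [O]. *)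
Definition differentially_private {Out : Type}
    (M : dataset -> set Out -> \bar R) (eps delta : R) : Prop :=
  forall S S' : dataset, neighboring S S' ->
  forall O : set Out, (M S O <= (expR eps)%:E * M S' O + delta%:E)%E.

Section user_weights.
Variables (A : {fset Sigma}) (b : Sigma -> R) (bmin bmax : R).

Let sqrtd : R := Num.sqrt (#|` A|%:R).

Definition biased : {fset Sigma} := [fset i in A | b i < 1].
Definition unbiased : {fset Sigma} := A `\` biased.

Definition biased_weight (i : Sigma) : R := Num.max bmin (b i) / sqrtd.

Definition initial_weights (i : Sigma) : R :=
  if i \notin A then 0
  else if i \in biased then biased_weight i
  else Num.min (bmax / sqrtd)
         (Num.sqrt ((1 - \sum_(j <- biased) biased_weight j ^+ 2)
                    / #|` unbiased|%:R)).

Definition sq_norm (w : Sigma -> R) : R := \sum_(i <- A) w i ^+ 2.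

Definition small (w : Sigma -> R) : {fset Sigma} :=
  [fset i in A | w i < sqrtd^-1].

(* The neutral element 0 of the maximum is harmless: weights are nonnegative. *)
Definition rescaling (w : Sigma -> R) : R :=
  Num.min (bmax / sqrtd / \big[Num.max/0]_(i <- small w) w i)
    (Num.sqrt (1 + (1 - sq_norm w) / \sum_(i <- small w) w i ^+ 2)).

Definition rescale_small (w : Sigma -> R) (i : Sigma) : R :=
  if i \in small w then rescaling w * w i else w i.

(* For A nonempty, 0 < bmin <= 1 <= bmax, the loop exits: each pass either makes
   the squared norm 1 or removes an item from [small], for good. For A empty it
   does not exit, and the result is the initial (zero) weight function. *)
Definition user_weights : Sigma -> R :=
  while (fun w => sq_norm w < 1) rescale_small initial_weights.

End user_weights.

Section mad.
Variables (S : dataset) (tau dmax : R) (b : Sigma -> R) (bmin bmax : R).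

Definition alpha : R := bmin - (2 * Num.sqrt dmax)^-1.

Definition adaptive (A : {fset Sigma}) : bool :=
  (Num.ceil (1 / bmin ^+ 2) <= #|` A|%:Z) && (#|` A|%:R <= dmax).

Definition w_init (i : Sigma) : R :=
  \sum_(A <- S | adaptive A && (i \in A)) (#|` A|%:R)^-1.

Definition excess_ratio (i : Sigma) : R :=
  if w_init i == 0 then 0 else Num.max 0 ((w_init i - tau) / w_init i).

Definition w_trunc (i : Sigma) : R := Num.min (w_init i) tau.

Definition excess (A : {fset Sigma}) : R :=
  (#|` A|%:R)^-1 * \sum_(i <- A) excess_ratio i.

Definition w_reroute (i : Sigma) : R :=
  \sum_(A <- S | adaptive A && (i \in A)) alpha * excess A / dmax.

Definition mad (i : Sigma) : R :=
  w_trunc i + w_reroute i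
  + \sum_(A <- S | adaptive A && (i \in A))
      (user_weights A b bmin bmax i - (#|` A|%:R)^-1)
  + \sum_(A <- S | ~~ adaptive A && (i \in A)) user_weights A b bmin bmax i.

End mad.

(* All possible outcomes, without repetition, of bounding the number of items of
   one user. *)
Definition bounded_subsets (Delta0 : nat) (A : {fset Sigma}) : seq {fset Sigma} :=
  if (#|` A| <= Delta0)%N then [:: A]
  else [seq B <- fpowerset A | #|` B| == Delta0].

(* Independent uniform choices for the users amount to one uniform draw from
   this list. *)
Definition bounded_datasets (Delta0 : nat) (S : dataset) : seq dataset :=
  foldr (fun A acc => [seq B :: T | B <- bounded_subsets Delta0 A, T <- acc])
    [:: [::]] S.

Definition threshold (bmax sigma delta : R) (Delta0 : nat) : R :=
  let F t := bmax / Num.sqrt t%:R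
             + sigma * Phi_inv ((1 - delta / 2) `^ (t%:R^-1)) in
  \big[Num.max/F 1%N]_(1 <= t < Delta0.+1) F t.

Section mad2r.
Variables (delta1 delta2 : R) (Delta0 : nat).
Variables (dmax beta Clb Cub bmin bmax sigma1 sigma2 : R).

(* Output once the user sets are bounded. [z1], [z2] list the noise added in rounds 1 and 2 to the successive items of
   [universe S]; round 2 only uses the coordinates of the items that remain. *)
Definition mad2r_output (S : dataset) (z1 z2 : seq R) : {fset Sigma} :=
  let U := universe S in
  let noise (z : seq R) i := nth 0 z (index i U) in
  let rho1 := threshold 1 sigma1 delta1 Delta0 in
  let w1 i := mad S (rho1 + beta * sigma1) dmax (fun=> 1) 1 1 i + noise z1 i in
  let U1 := [fset i in U | rho1 <= w1 i] in
  let rho2 := threshold bmax sigma2 delta2 Delta0 in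
  let w_lb i := Num.max 0 (w1 i - Clb * sigma1) in
  let w_ub i := w1 i + Cub * sigma1 in
  let Ulow := [fset i in U | w_ub i < rho2] in
  let S2 := [seq A `\` (U1 `|` Ulow) | A <- S] in
  let b i := if w_lb i == 0 then 1 else Num.min 1 (rho2 / w_lb i) in
  let w2 i :=
    mad S2 (rho2 + beta * sigma2) dmax b bmin bmax i + noise z2 i in
  let U2 := [fset i in universe S2 | rho2 <= w2 i] in
  U1 `|` U2.

Definition mad2r (S : dataset) (O : set {fset Sigma}) : \bar R :=
  let Ts := bounded_datasets Delta0 S in
  (((size Ts)%:R^-1)%:E *
   \sum_(T <- Ts)
     let n := #|` universe T| in
     (iid (normal_prob (0 : R) sigma1) n \x iid (normal_prob (0 : R) sigma2) n)
       [set z : n.-tuple R * n.-tuple R | O (mad2r_output T z.1 z.2)]%classic)%E.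

End mad2r.

End dataset.

Arguments dataset : clear implicits.

(** [sigma] is an admissible noise level for the (eps, delta) Gaussian mechanism
    of sensitivity 1. *)
Definition gaussian_noise_level {R : realType} (eps delta sigma : R) : Prop :=
  0 < sigma /\
  Phi ((2 * sigma)^-1 - eps * sigma)
  - expR eps * Phi (- (2 * sigma)^-1 - eps * sigma) <= delta.

(* Main.v *)
(** Fix the outcome of the subsampling of the users. In each round the noisy
    weights are, up to items that only the additional user holds, an instance of
    the Gaussian mechanism, because MAD has l2-sensitivity at most 1. For an
    adaptive user, truncation takes off weights that add up to some X, which
    lowers the l2-norm of his own contribution below 1 - kappa X, where
    kappa = bmin / sqrt d - 1 / (2 d); the rerouted weight has norm at most
    (alpha / sqrt dmax) X, and alpha is such that alpha / sqrt dmax <= kappa.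
    An item that only the additional user holds has weight at most
    bmax / sqrt t if there are t such items, so the choice of the threshold keeps
    all of them below it except with probability delta_r / 2. Outside this event
    the two runs enter round 2 with neighboring datasets and identical biases,
    and the two rounds compose.

    The Gaussian mechanism itself reduces to dimension 1: one more coordinate
    brings the norm of the shift to exactly 1, and the likelihood ratio is then a
    function of a single standard Gaussian direction.

    No measurability in the noise of round 1 is needed for the weights of
    round 2: the integral of an arbitrary nonnegative function is the supremum of
    the integrals of the simple functions below it, and these suffice for the
    inequalities, for permuting the items and for dropping unused noise. *)

From HB Require Import structures.
Require Import Defs.
From mathcomp Require Import all_boot all_order all_algebra finmap.
From mathcomp Require Import all_classical all_reals all_analysis.
From mathcomp Require Import measurable_realfun ring lra.

Set Implicit Arguments.
Unset Strict Implicit.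
Unset Printing Implicit Defensive.

Import Order.TTheory GRing.Theory Num.Theory.
Import numFieldNormedType.Exports.

Local Open Scope classical_set_scope.
Local Open Scope ring_scope.

(** * Gaussian integrals *)

Section gauss1.
Context {R : realType}.
Implicit Types (g : measurableTypeR R -> \bar R) (m s a b : R).
Local Open Scope ereal_scope.
Import HBNNSimple.

Local Notation mu := (@lebesgue_measure R).

(** The origin of [alpha]: [kappa] and [alpha / sqrt dmax] are the values of one function,
    [bmin * t - t ^+ 2 / 2], at [t = 1 / sqrt d] and at [t = 1 / sqrt dmax]. This function increases
    up to [bmin], and the two size bounds in [adaptive] say precisely that
    [1 / sqrt dmax <= 1 / sqrt d <= bmin]. Composing the rounds naively would multiply one of the
    deltas by an exponential. Therefore [delta2] is subtracted from the round 2 probability before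
    the two laws of round 1 are compared: the positive part of the difference still lies between 0
    and 1, so the Gaussian mechanism applies to it, and the additive errors simply add up. The
    exceptional event is charged to the law on the left of the inequality. As both directions are
    needed, the items of the additional user alone must stay below the threshold in both runs. *)

Lemma lebesgue_affine (a b : R) : a != 0%R -> forall A, measurable A ->
  mu A = (`|a|%:E * pushforward mu (fun x : measurableTypeR R => (a * x + b)%R : measurableTypeR R) A).
Proof.
move=> a0.
pose f := (fun x : measurableTypeR R => (a * x + b)%R : measurableTypeR R).
have mf : measurable_fun setT f.
  by apply: measurable_funD => //; apply: measurable_funM.
pose nu0 : {measure set (measurableTypeR R) -> \bar R} := pushforward mu f.
pose nu := nu0 mf.
have H : forall X, ocitv X -> mu X = mscale (NngNum (normr_ge0 a)) nu X.
  move=> _ [[c d] _ <-]; rewrite /mscale/= /pushforward/=.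
  case: (ltgtP a 0%R) a0 => // [a0|a0] _.
  (* A negative slope turns the interval around, so its closed end is now on the left. *)
  - have -> : f @^-1` `]c, d]%classic = `[((d - b) / a)%R, ((c - b) / a)%R[%classic.
      apply/seteqP; split => x /=; rewrite !in_itv/= /f => /andP[h1 h2].
        by rewrite ler_ndivrMr// ltr_ndivlMr//; apply/andP; split; lra.
      by move: h1 h2; rewrite ler_ndivrMr// ltr_ndivlMr// => h1 h2; apply/andP; split; lra.
    rewrite !lebesgue_measure_itv/= !lte_fin ltr_ndivrMr// mulrAC -mulrA divff ?lt_eqF// mulr1 ltrD2r.
    case: ifPn => cd; last by rewrite mule0.
    by rewrite ltr0_norm// -!EFinB -EFinM; congr EFin; field; rewrite lt_eqF.
  - have -> : f @^-1` `]c, d]%classic = `]((c - b) / a)%R, ((d - b) / a)%R]%classic.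
      apply/seteqP; split => x /=; rewrite !in_itv/= /f => /andP[h1 h2].
        by rewrite ltr_pdivrMr// ler_pdivlMr//; apply/andP; split; lra.
      by move: h1 h2; rewrite ltr_pdivrMr// ler_pdivlMr// => h1 h2; apply/andP; split; lra.
    rewrite !lebesgue_measure_itv/= !lte_fin ltr_pM2r ?invr_gt0// ltrD2r.
    case: ifPn => cd; last by rewrite mule0.
    by rewrite gtr0_norm// -!EFinB -EFinM; congr EFin; field; rewrite gt_eqF.
by move=> A mA; exact: (lebesgue_measure_unique H mA).
Qed.

Lemma integral_affine (a b : R) g : a != 0%R -> measurable_fun setT g -> (forall x, 0 <= g x) ->
  \int[mu]_x g x = `|a|%:E * \int[mu]_x g (a * x + b)%R.
Proof.
move=> a0 mg g0.
pose f := (fun x : measurableTypeR R => (a * x + b)%R : measurableTypeR R).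
have mf : measurable_fun setT f.
  by apply: measurable_funD => //; apply: measurable_funM.
have := ge0_integral_pushforward mf mu measurableT mg (fun x _ => g0 x).
rewrite preimage_setT /= => <-.
pose nu0 : {measure set (measurableTypeR R) -> \bar R} := pushforward mu f.
pose nu := nu0 mf.
rewrite -(@ge0_integral_mscale _ _ _ nu _ measurableT (NngNum (normr_ge0 a)))//.
by apply: eq_measure_integral => A mA _; exact: (lebesgue_affine b a0 mA).
Qed.

(** On indicators this is the definition of [normal_prob]; linearity and monotone convergence along
    simple functions extend it. *)
Lemma integral_normal_prob m s g : measurable_fun setT g -> (forall x, 0 <= g x) ->
  \int[normal_prob m s]_x g x = \int[mu]_x (g x * (normal_pdf m s x)%:E).
Proof.
move=> mg g0.
pose p (x : measurableTypeR R) := (normal_pdf m s x)%:E.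
have mp : measurable_fun setT p by apply/measurable_EFinP; exact: measurable_normal_pdf.
have p0 x : 0 <= p x by rewrite lee_fin normal_pdf_ge0.
have Hind (E : set (measurableTypeR R)) : measurable E ->
    \int[normal_prob m s]_x (\1_E x)%:E = \int[mu]_x ((\1_E x)%:E * p x).
  move=> mE; rewrite integral_indic//= setIT /normal_prob.
  rewrite [LHS]integral_mkcond; apply: eq_integral => x _.
  by rewrite patchE indicE; case: ifPn => _; rewrite ?mul1e ?mul0e.
pose f := nnsfun_approx measurableT mg.
have fg x : (EFin \o f^~ x) n @[n --> \oo] --> g x by exact: cvg_nnsfun_approx.
have ndf x i j : (i <= j)%N -> ((f i x)%:E <= (f j x)%:E)%E.
  by move=> ij; rewrite lee_fin; exact/lefP/nd_nnsfun_approx.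
transitivity (limn (fun n => \int[normal_prob m s]_x (f n x)%:E)).
  rewrite -monotone_convergence//=.
  - by apply: eq_integral => x _; apply/esym/cvg_lim => //; exact: fg.
  - by move=> n; exact/measurable_EFinP.
  - by move=> n x _; rewrite lee_fin.
  - by move=> x _ a b; exact: ndf.
transitivity (limn (fun n => \int[mu]_x ((f n x)%:E * p x))); last first.
  rewrite -monotone_convergence//=.
  - apply: eq_integral => x _; apply/cvg_lim => //.
    by apply: cvgeZr => //; exact: fg.
  - by move=> n; apply: emeasurable_funM => //; exact/measurable_EFinP.
  - by move=> n x _; rewrite mule_ge0// lee_fin.
  - by move=> x _ a b ab; rewrite lee_wpmul2r// ndf.
congr (limn _); apply/funext => n.
under eq_integral do rewrite fimfunE -fsumEFin//.
rewrite ge0_integral_fsum//; last 2 first.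
  - by move=> r; exact/measurable_EFinP/measurableT_comp.
  - by move=> r x _; rewrite EFinM nnfun_muleindic_ge0.
under [RHS]eq_integral.
  move=> x _; rewrite fimfunE -fsumEFin// ge0_mule_fsuml; last first.
    by move=> r; rewrite EFinM nnfun_muleindic_ge0.
  over.
rewrite [RHS]ge0_integral_fsum//; last 2 first.
  - by move=> r; apply: emeasurable_funM => //; apply/measurable_EFinP/measurableT_comp.
  - by move=> r x _; rewrite mule_ge0// EFinM nnfun_muleindic_ge0.
apply: eq_fsbigr => r; rewrite inE => -[x0 _ x0r].
have r0 : (0 <= r)%R by rewrite -x0r.
under eq_integral do rewrite EFinM.
rewrite ge0_integralZl//; last exact/measurable_EFinP.
rewrite Hind// -ge0_integralZl//.
- by apply: eq_integral => x _; rewrite EFinM muleA.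
- by apply: emeasurable_funM => //; exact/measurable_EFinP.
- by move=> x _; rewrite mule_ge0// lee_fin.
Qed.

End gauss1.

Lemma integral_prob_cst d (T : measurableType d) (R : realType) (P : probability T R)
  (c : \bar R) : (\int[P]_x c = c)%E.
Proof. by rewrite integral_cst//; have /= -> := probability_setT P; rewrite mule1. Qed.

(** The left side is [z ^+ 2 + y ^+ 2] in the coordinates [y] and [t = a * y + b * z]. On the right
    [y] occurs in a single square, so it can be integrated out. *)
Lemma gauss_complete_square (F : fieldType) (a b c t y : F) :
  b != 0 -> c != 0 -> c ^+ 2 = a ^+ 2 + b ^+ 2 ->
  (b^-1 * t + - (a * y / b)) ^+ 2 + y ^+ 2 =
  (c^-1 * t) ^+ 2 + (c / b * y + - (a * t / (b * c))) ^+ 2.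
Proof.
move=> b0 c0 c2; apply/eqP; rewrite -subr_eq0.
have -> : (b^-1 * t + - (a * y / b)) ^+ 2 + y ^+ 2 -
  ((c^-1 * t) ^+ 2 + (c / b * y + - (a * t / (b * c))) ^+ 2) =
  (c ^+ 2 - (a ^+ 2 + b ^+ 2)) * (- y ^+ 2 / b ^+ 2 - - t ^+ 2 / (b ^+ 2 * c ^+ 2)) .
  by field; rewrite b0 c0.
by rewrite c2 subrr mul0r.
Qed.

Section gauss2.
Context {R : realType}.
Implicit Types g : measurableTypeR R -> \bar R.
Local Open Scope ereal_scope.

Local Notation mu := (@lebesgue_measure R).
Local Notation N s := (normal_prob (0 : R)%R s).

Lemma measurable_affine (a b : R) :
  measurable_fun setT (fun x : measurableTypeR R => (a * x + b)%R : measurableTypeR R).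
Proof. by apply: measurable_funD => //; apply: measurable_funM. Qed.

Lemma measurable_normal_pdfE (m s : R) :
  measurable_fun setT (fun x : measurableTypeR R => (normal_pdf m s x)%:E).
Proof. by apply/measurable_EFinP; exact: measurable_normal_pdf. Qed.

Lemma normal_pdfE_ge0 (m s x : R) : 0 <= (normal_pdf m s x)%:E.
Proof. by rewrite lee_fin normal_pdf_ge0. Qed.

(** The exponential is the likelihood ratio of the normal law of mean [m] to the centred one. *)
Lemma integral_normal_shift (s m : R) g : s != 0%R -> measurable_fun setT g ->
    (forall x, 0 <= g x) ->
  \int[N s]_x g (x + m)%R =
  \int[N s]_x (g x * (expR (m * x / s ^+ 2 - m ^+ 2 / (2 * s ^+ 2)))%:E).
Proof.
move=> s0 mg g0.
have mgm : measurable_fun setT (fun x : measurableTypeR R => g (x + m)%R).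
  apply: (measurableT_comp mg); have := measurable_affine 1 m.
  by apply: eq_measurable_fun => x _; rewrite mul1r.
have mexp : measurable_fun setT (fun x : measurableTypeR R =>
    (expR (m * x / s ^+ 2 - m ^+ 2 / (2 * s ^+ 2)))%:E).
  apply/measurable_EFinP; apply: measurableT_comp => //; apply: measurable_funB => //.
  by apply: measurable_funM => //; apply: measurable_funM.
rewrite !integral_normal_prob//; last 2 first.
- exact: emeasurable_funM.
- by move=> x; rewrite mule_ge0// lee_fin expR_ge0.
pose h (y : measurableTypeR R) := g y * (normal_pdf 0 s (y - m))%:E.
have mh : measurable_fun setT h.
  apply: emeasurable_funM => //; apply: (measurableT_comp (measurable_normal_pdfE 0 s)).
  have := measurable_affine 1 (- m).
  by apply: eq_measurable_fun => x _; rewrite mul1r.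
have h0 x : 0 <= h x by rewrite mule_ge0// normal_pdfE_ge0.
transitivity (\int[mu]_x h x).
  rewrite (@integral_affine _ 1 m h)// normr1 mul1e.
  by apply: eq_integral => x _; rewrite /h mul1r addrK.
apply: eq_integral => x _; rewrite /h -muleA -EFinM; congr (_ * _%:E).
rewrite !normal_pdfE// /normal_fun mulrCA -expRD; congr (_ * expR _)%R.
by rewrite !subr0; field; rewrite s0.
Qed.

Lemma integral_normalN (s : R) g : s != 0%R -> measurable_fun setT g ->
    (forall x, 0 <= g x) ->
  \int[N s]_x g (- x)%R = \int[N s]_x g x.
Proof.
move=> s0 mg g0.
have mgN : measurable_fun setT (fun x : measurableTypeR R => g (- x)%R).
  apply: (measurableT_comp mg); have := measurable_affine (-1) 0.
  by apply: eq_measurable_fun => x _; rewrite addr0 mulN1r.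
rewrite !integral_normal_prob// [RHS](@integral_affine _ (-1) 0)//.
- rewrite normrN1 mul1e; apply: eq_integral => x _; rewrite addr0 mulN1r.
  by rewrite !normal_pdfE// /normal_fun !subr0 sqrrN.
- by apply: emeasurable_funM => //; exact: measurable_normal_pdfE.
- by move=> x; rewrite mule_ge0// normal_pdfE_ge0.
Qed.

(** Stability of the normal law. Substitute [t = a * y + b * z] in the inner integral, exchange the
    integrals and complete the square: the factor in [y] integrates to a constant, and the remaining
    one is the density of [t]. *)
Lemma integral_normal_add (s a b : R) g : s != 0%R -> measurable_fun setT g ->
    (forall x, 0 <= g x) ->
  \int[N s]_y \int[N s]_z g (a * y + b * z)%R =
  \int[N s]_y g (Num.sqrt (a ^+ 2 + b ^+ 2) * y)%R.
Proof.
move=> s0 mg g0.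
have mga (c d : R) : measurable_fun setT (fun x : measurableTypeR R => g (c * x + d)%R).
  by apply: (measurableT_comp mg); exact: measurable_affine.
have mga0 (c : R) : measurable_fun setT (fun x : measurableTypeR R => g (c * x)%R).
  by have := mga c 0%R; apply: eq_measurable_fun => x _; rewrite addr0.
(* The substitution divides by [b]. Without [b], only the sign of [a] has to be absorbed, by
   symmetry. *)
have [->|b0] := eqVneq b 0%R.
  rewrite expr0n/= addr0 sqrtr_sqr.
  transitivity (\int[N s]_y g (a * y)%R).
    apply: eq_integral => y _; under eq_integral do rewrite mul0r addr0.
    exact: integral_prob_cst.
  case: (lerP 0 a) => a0; first by rewrite ger0_norm.
  rewrite -[RHS]integral_normalN//.
  by apply: eq_integral => y _; rewrite ltr0_norm// mulrNN.
pose p (x : measurableTypeR R) := (normal_pdf 0 s x)%:E.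
have mp : measurable_fun setT p by exact: measurable_normal_pdfE.
have mpa (c d : R) : measurable_fun setT (fun x : measurableTypeR R => p (c * x + d)%R).
  by apply: (measurableT_comp mp); exact: measurable_affine.
have p0 x : 0 <= p x by exact: normal_pdfE_ge0.
have intp : \int[mu]_x p x = 1 by exact: integral_normal_pdf.
pose c := Num.sqrt (a ^+ 2 + b ^+ 2).
have ab0 : (0 < a ^+ 2 + b ^+ 2)%R by rewrite ltr_wpDl ?sqr_ge0// exprn_even_gt0.
have c0 : (0 < c)%R by rewrite sqrtr_gt0.
have c2 : (c ^+ 2 = a ^+ 2 + b ^+ 2)%R by rewrite sqr_sqrtr// ltW.
have mab (y : R) : measurable_fun setT (fun z : measurableTypeR R => g (a * y + b * z)%R).
  by have := mga b (a * y)%R; apply: eq_measurable_fun => x _; rewrite addrC.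
rewrite integral_normal_prob; last 2 first.
- apply: (@measurable_fun_fubini_tonelli_F _ _ (measurableTypeR R) (measurableTypeR R) R (N s)
    (fun yz => g (a * yz.1 + b * yz.2)%R)) => //.
  by apply: (measurableT_comp mg); apply: measurable_funD; apply: measurable_funM.
- by move=> y; apply: integral_ge0.
pose q (y t : measurableTypeR R) := p (b^-1 * t + - (a * y / b))%R.
have inner (y : R) : \int[N s]_z g (a * y + b * z)%R =
    \int[mu]_t (`|b^-1|%:E * (g t * q y t)).
  rewrite integral_normal_prob// (@integral_affine _ b^-1 (- (a * y / b)))//.
  + rewrite ge0_integralZl//.
    * by congr (_ * _); apply: eq_integral => t _; congr (g _ * _); field; rewrite b0.
    * by apply: emeasurable_funM => //; exact: mpa.
    * by move=> t _; apply: mule_ge0; [exact: g0|exact: p0].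
  + by rewrite invr_neq0.
  + by apply: emeasurable_funM => //; exact: measurable_normal_pdfE.
  + by move=> t; apply: mule_ge0; [exact: g0|exact: p0].
have mq : measurable_fun setT (fun yt : measurableTypeR R * measurableTypeR R => q yt.1 yt.2).
  apply: (measurableT_comp mp); apply: measurable_funD; first exact: measurable_funM.
  apply: measurableT_comp => //; apply: measurable_funM => //; exact: measurable_funM.
under eq_integral do rewrite inner.
pose F (yt : measurableTypeR R * measurableTypeR R) :=
  `|b^-1|%:E * (g yt.2 * q yt.1 yt.2) * p yt.1.
have F0 yt : 0 <= F yt by rewrite !mule_ge0//; exact: p0.
have mF : measurable_fun setT F.
  apply: emeasurable_funM; last exact: (measurableT_comp mp).
  apply: emeasurable_funM => //; apply: emeasurable_funM => //.
  exact: (measurableT_comp mg).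
transitivity (\int[mu]_y \int[mu]_t F (y, t)).
  apply: eq_integral => y _; rewrite /F/= ge0_integralZr//.
  - apply: emeasurable_funM => //; apply: emeasurable_funM => //; exact: mpa.
  - by move=> t _; rewrite !mule_ge0//; exact: p0.
rewrite (fubini_tonelli _ mF)//.
transitivity (\int[mu]_t ((g t * p (c^-1 * t)%R) * (`|c^-1|)%:E)).
  apply: eq_integral => t _.
  transitivity (\int[mu]_y ((`|b^-1|%:E * g t * p (c^-1 * t)%R) *
                              p (c / b * y + - (a * t / (b * c)))%R)).
    apply: eq_integral => y _; rewrite /F/= -!muleA; congr (_ * (_ * _)).
    rewrite /q /p -!EFinM; congr EFin; rewrite !normal_pdfE// /normal_fun.
    rewrite mulrACA [in RHS]mulrACA -!expRD; congr (_ * expR _)%R.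
    rewrite !subr0 !mulNr -!opprD -!mulrDl.
    by rewrite (gauss_complete_square _ _ b0 (lt0r_neq0 c0) c2).
  rewrite ge0_integralZl//; last first.
  - by rewrite !mule_ge0//; exact: p0.
  have : `|c / b|%:E * \int[mu]_y p (c / b * y + - (a * t / (b * c)))%R = 1.
    rewrite -intp; apply/esym/integral_affine => //.
    by rewrite mulf_neq0 ?invr_neq0 ?(gt_eqF c0).
  have -> : (`|b^-1| = `|c^-1| * `|c / b|)%R.
    by rewrite -normrM mulrA mulVf ?mul1r ?(gt_eqF c0).
  move=> HI.
  rewrite EFinM -!muleA (muleCA _ (g t)) (muleCA _ (p _)).
  by move: HI => /= ->; rewrite mule1 muleC muleA.
rewrite [RHS]integral_normal_prob//.
have mpc : measurable_fun setT (fun t : measurableTypeR R => p (c^-1 * t)%R).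
  by have := mpa c^-1%R 0%R; apply: eq_measurable_fun => x _; rewrite addr0.
have c0' : c != 0%R by rewrite gt_eqF.
rewrite [LHS](@integral_affine _ c 0)//.
- rewrite -ge0_integralZl//.
  + apply: eq_integral => x _; rewrite addr0 mulKf// muleC -muleA -EFinM -normrM mulVf//.
    by rewrite normr1 mule1.
  + do 2 (apply: emeasurable_funM => //).
    have := mpa (c^-1 * c)%R 0%R.
    by apply: eq_measurable_fun => x _; rewrite !addr0 mulrA.
  + by move=> t _; rewrite !mule_ge0//; exact: p0.
- by do 2 (apply: emeasurable_funM => //).
- by move=> t; rewrite !mule_ge0//; exact: p0.
Qed.

End gauss2.

(** * The standard Gaussian distribution function *)

Section gauss_cdf.
Context {R : realType}.
Local Open Scope ereal_scope.

Local Notation N s := (normal_prob (0 : R)%R s).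

Lemma integral_normal_scale (s : R) (g : measurableTypeR R -> \bar R) :
    s != 0%R -> measurable_fun setT g -> (forall x, 0 <= g x) ->
  \int[N s]_x g x = \int[N 1]_x g (s * x)%R.
Proof.
move=> s0 mg g0; have mgs : measurable_fun setT (fun x : measurableTypeR R => g (s * x)%R).
  by apply: (measurableT_comp mg); exact: measurable_funM.
rewrite (integral_normal_prob 0 s mg g0) (integral_normal_prob 0 1 mgs) => [|x]; last exact: g0.
rewrite (@integral_affine _ s 0%R)//.
- rewrite -ge0_integralZl//.
  + apply: eq_integral => x _; rewrite addr0 muleCA -EFinM; congr (_ * _%:E).
    rewrite !normal_pdfE ?oner_neq0// /normal_fun /normal_peak !subr0 mulrA; congr (_ * expR _)%R.
      by rewrite expr1n mul1r -mulrnAr sqrtrM ?sqr_ge0// sqrtr_sqr invfM mulVKf ?normr_eq0.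
    by rewrite expr1n exprMn; field.
  + apply: emeasurable_funM; first by under eq_fun do rewrite addr0.
    apply: (measurableT_comp (measurable_normal_pdfE 0%R s)); exact: measurable_affine.
  + by move=> x _; rewrite mule_ge0// normal_pdfE_ge0.
- by apply: emeasurable_funM => //; exact: measurable_normal_pdfE.
- by move=> x; rewrite mule_ge0// normal_pdfE_ge0.
Qed.

Lemma Phi_fin (x : R) : (Phi x)%:E = N 1 `]-oo, x].
Proof. by rewrite /Phi fineK// fin_num_measure. Qed.

Lemma normal_prob_set1 (s x : R) : N s [set x] = 0.
Proof.
have := @normal_prob_dominates R 0 s.
move=> /null_content_dominatesP; apply => //; exact: lebesgue_measure_set1.
Qed.

Lemma normal_prob_indic (s : R) (A : set (measurableTypeR R)) : measurable A ->
  N s A = \int[N s]_x (\1_A x)%:E.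
Proof. by move=> mA; rewrite integral_indic// setIT. Qed.

Lemma normal_prob_ray (s x : R) : N s `]-oo, x[ = N s `]-oo, x].
Proof.
have -> : `]-oo, x]%classic = `]-oo, x[%classic `|` [set x].
  apply/seteqP; split => y /=; rewrite !in_itv/= le_eqVlt.
    by move=> /orP[/eqP|]; [right|left].
  by move=> [->|->]; rewrite ?eqxx ?orbT.
rewrite measureU//.
- by have /= -> := normal_prob_set1 s x; rewrite adde0.
- by apply/seteqP; split => y //= []; rewrite in_itv/= => /[swap] ->; rewrite ltxx.
Qed.

Lemma measurable_indicE (A : set (measurableTypeR R)) : measurable A ->
  measurable_fun setT (fun x => (\1_A x)%:E : \bar R).
Proof. by move=> mA; apply/measurable_EFinP. Qed.

Lemma normal_prob_scale (s : R) (A : set (measurableTypeR R)) : s != 0%R ->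
  measurable A -> N s A = N 1 ( *%R s @^-1` A).
Proof.
move=> s0 mA; have mB : measurable ( *%R s @^-1` A : set (measurableTypeR R)).
  rewrite -[X in measurable X]setTI.
  have mM : measurable_fun setT (fun x : measurableTypeR R => (s * x)%R : measurableTypeR R).
    exact: measurable_funM.
  exact: mM.
rewrite (normal_prob_indic s mA) (normal_prob_indic 1 mB).
exact: (integral_normal_scale s0 (measurable_indicE mA)).
Qed.

Lemma normal_probN (s : R) (A : set (measurableTypeR R)) : s != 0%R ->
  measurable A -> N s A = N s (-%R @^-1` A).
Proof.
move=> s0 mA; have mB : measurable (-%R @^-1` A : set (measurableTypeR R)).
  rewrite -[X in measurable X]setTI.
  have mM : measurable_fun setT (fun x : measurableTypeR R => (- x)%R : measurableTypeR R).
    exact: measurable_funN.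
  exact: mM.
rewrite (normal_prob_indic s mA) (normal_prob_indic s mB).
apply/esym; exact: (integral_normalN s0 (measurable_indicE mA)).
Qed.

Lemma normal_prob_lt (s x : R) : (0 < s)%R -> N s `]-oo, x[ = (Phi (x / s))%:E.
Proof.
move=> s0; rewrite Phi_fin normal_prob_ray normal_prob_scale ?gt_eqF//.
by congr (N 1 _); apply/seteqP; split => y/=; rewrite !in_itv/= ler_pdivlMr// mulrC.
Qed.

Lemma normal_prob_ge_compl (s x : R) : N s `[x, +oo[ = 1 - N s `]-oo, x[.
Proof. by rewrite -setCitvl; exact: probability_setC. Qed.

Lemma PhiN (x : R) : Phi (- x) = (1 - Phi x)%R.
Proof.
apply: EFin_inj; rewrite EFinB (Phi_fin x) -(normal_prob_ray 1 x) -normal_prob_ge_compl.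
rewrite (@normal_probN 1 `[x, +oo[) ?oner_neq0// Phi_fin.
by congr (N 1 _); apply/seteqP; split => y /=; rewrite !in_itv/= ?andbT lerNr.
Qed.

Lemma normal_prob_ge (s x : R) : (0 < s)%R -> N s `[x, +oo[ = (Phi (- (x / s)))%:E.
Proof.
by move=> s0; rewrite normal_prob_ge_compl normal_prob_lt// PhiN.
Qed.

Lemma Phi_le (x y : R) : (x <= y)%R -> (Phi x <= Phi y)%R.
Proof.
move=> xy; rewrite -lee_fin !Phi_fin; apply: le_measure; rewrite ?inE//.
by apply: subset_itvl; rewrite bnd_simp.
Qed.

(** The density is at most its peak. This serves to make [Phi] continuous. *)
Lemma Phi_lipschitz (x y : R) : (x <= y)%R -> (Phi y - Phi x <= normal_peak 1 * (y - x))%R.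
Proof.
move=> xy; rewrite -lee_fin EFinB !Phi_fin.
have -> : `]-oo, y]%classic = `]-oo, x]%classic `|` `]x, y]%classic.
  by rewrite -itv_bndbnd_setU// bnd_simp.
rewrite measureU//; last first.
  apply/seteqP; split => z //= []; rewrite !in_itv/= => h /andP[h' _].
  by move: (lt_le_trans h' h); rewrite ltxx.
rewrite addeAC subee ?fin_num_measure// add0e /normal_prob.
apply: (@le_trans _ _ (\int[lebesgue_measure]_(z in `]x, y]) (normal_peak 1)%:E)).
  apply: ge0_le_integral => //=.
  - by move=> z _; exact: normal_pdfE_ge0.
  - by apply: measurable_funTS; exact: measurable_normal_pdfE.
  - by move=> z _; rewrite lee_fin normal_pdf_ub// oner_neq0.
rewrite integral_cst//= lebesgue_measure_itv/= lte_fin -EFinB.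
case: ifPn => [_|]; first by rewrite lee_fin.
by rewrite -leNgt mule0 lee_fin mulr_ge0 ?normal_peak_ge0 ?subr_ge0.
Qed.

Lemma Phi_cont : continuous (@Phi R).
Proof.
have K0 : (0 < @normal_peak R 1)%R by rewrite normal_peak_gt0// oner_neq0.
move=> x; apply/cvgrPdist_le => e e0; near=> y.
have yx : (`|x - y| <= e / normal_peak 1)%R.
  near: y; apply: cvgr_dist_le; [exact: cvg_id|by rewrite divr_gt0].
have {}yx : (normal_peak 1 * `|x - y| <= e)%R by rewrite mulrC -ler_pdivlMr.
apply: le_trans yx; have [xy|yx] := leP x y.
- rewrite distrC (distrC x) !ger0_norm ?subr_ge0 ?Phi_le//.
  exact: Phi_lipschitz.
- by rewrite !ger0_norm ?subr_ge0 ?Phi_le ?(ltW yx)//; exact: Phi_lipschitz (ltW yx).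
Unshelve. all: by end_near. Qed.

Lemma Phi_gt (p : R) : (p < 1)%R -> exists x, (p < Phi x)%R.
Proof.
move=> p1.
have mX : measurable_fun setT (fun x : measurableTypeR R => x : R) by exact: measurable_id.
pose X : {RV (N 1) >-> R} :=
  HB.pack (fun x : measurableTypeR R => x : R) (isMeasurableFun.Build _ _ _ _ _ mX).
have : (fine \o cdf X) r @[r --> +oo%R] --> (1 : R)%R.
  by apply: fine_cvg; exact: cvg_cdfy1.
move=> /cvgr_gt /(_ _ p1) [M [_ hM]].
by exists (M + 1)%R; have := hM (M + 1)%R; rewrite ltrDl ltr01 => /(_ isT).
Qed.

(** [Phi_inv] takes its default value only if [p] has no preimage. The intermediate value theorem
    excludes this, since [Phi] exceeds [p] somewhere and, by symmetry, is below [p] elsewhere. *)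
Lemma Phi_invK (p : R) : (0 < p < 1)%R -> Phi (Phi_inv p) = p.
Proof.
move=> /andP[p0 p1]; rewrite /Phi_inv; case: xgetP => [//|nex].
have [a pa] := Phi_gt p1.
have [b pb] : exists b, (Phi b < p)%R.
  have [|b hb] := @Phi_gt (1 - p)%R; first by lra.
  by exists (- b)%R; rewrite PhiN; lra.
have ba : (b <= a)%R.
  by rewrite leNgt; apply/negP => /ltW /Phi_le; lra.
have [] := @IVT R (@Phi R) b a p ba.
- by apply: continuous_subspaceT => x; exact: Phi_cont.
- by rewrite ge_min le_max !(ltW pb, ltW pa) orbT.
by move=> c _ Pc; exfalso; exact: (nex c).
Qed.

(** By symmetry [Phi 0 = 1 / 2]. This is what makes a threshold at least [bmax]. *)
Lemma Phi_inv_ge0 (p : R) : (1 / 2 < p < 1)%R -> (0 <= Phi_inv p)%R.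
Proof.
move=> /andP[p2 p1]; rewrite leNgt; apply/negP => /ltW/Phi_le.
have := PhiN 0; rewrite oppr0 Phi_invK; lra.
Qed.
End gauss_cdf.

(** * The Gaussian mechanism *)

Section iid_integral.
Context d (T : measurableType d) (R : realType) (P : probability T R).
Local Open Scope ereal_scope.

Lemma iid_integral0 (f : 0.-tuple T -> \bar R) : (forall z, 0 <= f z) ->
  \int[iid P 0]_z f z = f [tuple].
Proof.
move=> f0; have -> : f = cst (f [tuple]).
  by apply/funext => z; rewrite [z]tuple0.
exact: integral_prob_cst.
Qed.

Lemma iid_integralS n (f : n.+1.-tuple T -> \bar R) : measurable_fun setT f ->
  (forall z, 0 <= f z) ->
  \int[iid P n.+1]_z f z = \int[P]_x \int[iid P n]_z f (tcons (x, z)).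
Proof.
move=> mf f0; rewrite /= ge0_integral_distribution// fubini_tonelli1//; last by move=> z; exact: f0.
by apply: (measurableT_comp mf).
Qed.

Lemma measurable_tcons_section n (f : n.+1.-tuple T -> \bar R) x : measurable_fun setT f ->
  measurable_fun setT (fun z : n.-tuple T => f (tcons (x, z))).
Proof.
move=> mf; apply: (measurableT_comp mf).
by apply: (@measurable_cons _ _ _ T (cst x) n id).
Qed.

Lemma measurable_iid_integral d0 (T0 : measurableType d0) n (F : T0 * n.-tuple T -> \bar R) :
  measurable_fun setT F -> (forall z, 0 <= F z) ->
  measurable_fun setT (fun x => \int[iid P n]_z F (x, z)).
Proof. by move=> mF F0; exact: (@measurable_fun_fubini_tonelli_F _ _ _ _ _ (iid P n) F). Qed.

Lemma measurable_iid_section n (f : n.+1.-tuple T -> \bar R) : measurable_fun setT f ->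
  (forall z, 0 <= f z) ->
  measurable_fun setT (fun x : T => \int[iid P n]_z f (tcons (x, z))).
Proof.
move=> mf f0.
exact: (@measurable_iid_integral _ T n (f \o @tcons _ T n)
  (measurableT_comp mf (@measurable_tcons _ T n)) (fun z => f0 _)).
Qed.

Lemma tnth_tcons0 n x (z : n.-tuple T) : tnth (tcons (x, z)) ord0 = x.
Proof. by []. Qed.

Lemma tnth_tconsS n x (z : n.-tuple T) i : tnth (tcons (x, z)) (lift ord0 i) = tnth z i.
Proof. by rewrite /tcons tnthS. Qed.

End iid_integral.

Section iid_gauss.
Context {R : realType}.
Local Open Scope ereal_scope.
Local Notation X := (measurableTypeR R).
Local Notation N s := (normal_prob (0 : R)%R s).

(** The shift is indexed by [nat], so that removing the first coordinate turns it into [mu \o S]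
    without any cast. *)
Definition translate n (mu : nat -> R) (z : n.-tuple X) : n.-tuple X :=
  [tuple (tnth z i + mu i)%R | i < n].

Definition dot n (mu : nat -> R) (z : n.-tuple X) : R := (\sum_(i < n) mu i * tnth z i)%R.

Lemma measurable_translate n mu : measurable_fun setT (@translate n mu).
Proof.
apply/measurable_fun_tnthP => i.
rewrite (_ : _ \o _ = fun z : n.-tuple X => (tnth z i + mu i)%R : X); last first.
  by apply/funext => z; rewrite /= tnth_mktuple.
by apply: measurable_funD => //; exact: measurable_tnth.
Qed.

Lemma translate_tcons n mu x (z : n.-tuple X) :
  translate mu (tcons (x, z)) = tcons ((x + mu 0)%R : X, translate (mu \o S) z).
Proof.
apply: eq_from_tnth => i; rewrite tnth_mktuple.
case: (unliftP ord0 i) => [j|] ->.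
  by rewrite !tnth_tconsS tnth_mktuple.
by rewrite !tnth_tcons0.
Qed.

Lemma dot_tcons n mu x (z : n.-tuple X) :
  dot mu (tcons (x, z)) = (mu 0 * x + dot (mu \o S) z)%R.
Proof.
rewrite /dot big_ord_recl tnth_tcons0; congr (_ + _)%R.
by apply: eq_bigr => i _; rewrite tnth_tconsS.
Qed.

Lemma measurable_dot n mu : measurable_fun setT (@dot n mu).
Proof. by apply: measurable_sum => i; apply: measurable_funM => //; exact: measurable_tnth. Qed.

(** The likelihood ratio of shifted to centred Gaussian noise, where [v] is the squared norm of the
    shift and [t] its inner product with the noise. *)
Definition gauss_ratio (s v t : R) := expR (t / s ^+ 2 - v / (2 * s ^+ 2))%R.

Lemma gauss_ratio_ge0 s v t : (0 <= gauss_ratio s v t)%R.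
Proof. exact: expR_ge0. Qed.

Lemma measurable_gauss_ratio s v : measurable_fun setT (gauss_ratio s v).
Proof.
apply: measurableT_comp => //; apply: measurable_funB => //; exact: measurable_funM.
Qed.

Lemma gauss_ratioD s v w t u :
  gauss_ratio s (v + w) (t + u) = (gauss_ratio s v t * gauss_ratio s w u)%R.
Proof. by rewrite /gauss_ratio -expRD !mulrDl opprD addrACA. Qed.

Section abstract_gauss.
Variables (P : probability X R) (s : R).
Hypothesis shiftP : forall (m : R) (g : X -> \bar R), measurable_fun setT g ->
  (forall x, 0 <= g x) ->
  \int[P]_x g (x + m)%R = \int[P]_x (g x * (gauss_ratio s (m ^+ 2) (m * x))%:E).
Hypothesis addP : forall (a b : R) (g : X -> \bar R), measurable_fun setT g ->
  (forall x, 0 <= g x) ->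
  \int[P]_y \int[P]_z g (a * y + b * z)%R =
  \int[P]_y g (Num.sqrt (a ^+ 2 + b ^+ 2) * y)%R.

(** By independence the ratios of the coordinates multiply, so squared norms and inner products add
    up in the exponent. *)
Lemma iid_translate n (mu : nat -> R) (f : n.-tuple X -> \bar R) :
    measurable_fun setT f -> (forall z, 0 <= f z) ->
  \int[iid P n]_z f (translate mu z) =
  \int[iid P n]_z (f z * (gauss_ratio s (\sum_(i < n) mu i ^+ 2) (dot mu z))%:E).
Proof.
elim: n mu f => [|n IH] mu f mf f0.
  rewrite !iid_integral0//.
  - rewrite /dot !big_ord0 /gauss_ratio !mul0r subrr expR0 mule1.
    by congr f; apply: tuple0.
  - by move=> z; rewrite mule_ge0// lee_fin gauss_ratio_ge0.
have mfr k (v : R) (h : k.-tuple X -> \bar R) nu : measurable_fun setT h ->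
    measurable_fun setT (fun z => h z * (gauss_ratio s v (dot nu z))%:E).
  move=> mh; apply: emeasurable_funM => //; apply/measurable_EFinP.
  by apply: (measurableT_comp (measurable_gauss_ratio s v)); exact: measurable_dot.
have r0 (h : \bar R) v t : 0 <= h -> 0 <= h * (gauss_ratio s v t)%:E.
  by move=> h0; rewrite mule_ge0// lee_fin gauss_ratio_ge0.
have mft : measurable_fun setT (f \o @translate n.+1 mu).
  exact: (measurableT_comp mf (measurable_translate mu)).
rewrite (iid_integralS P mft); last by move=> z; exact: f0.
rewrite (iid_integralS P (mfr _ _ _ mu mf)); last by move=> z; apply: r0; exact: f0.
rewrite /comp.
under eq_integral do under eq_integral do rewrite translate_tcons.
pose V := (\sum_(i < n) (mu \o S) i ^+ 2)%R.
pose F (z : n.+1.-tuple X) := f z * (gauss_ratio s V (dot (mu \o S) (behead_tuple z)))%:E.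
have F0 z : 0 <= F z by exact: r0.
have mF : measurable_fun setT F.
  apply: emeasurable_funM => //; apply/measurable_EFinP.
  apply: (measurableT_comp (measurable_gauss_ratio s V)).
  by apply: (measurableT_comp (@measurable_dot n _)); exact: measurable_behead.
pose g (x : X) := \int[iid P n]_z F (tcons (x, z)).
transitivity (\int[P]_x g (x + mu 0%N)%R).
  apply: eq_integral => x _.
  have mfx := measurable_tcons_section ((x + mu 0%N)%R : X) mf.
  have fx0 (z : n.-tuple X) : 0 <= f (tcons ((x + mu 0%N)%R : X, z)) by exact: f0.
  rewrite (IH (mu \o S) _ mfx fx0).
  by apply: eq_integral => z _; rewrite /F; congr (_ * (gauss_ratio s V (dot _ _))%:E); apply: val_inj.
have mg : measurable_fun setT g by exact: (measurable_iid_section P mF F0).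
have g0 x : 0 <= g x by apply: integral_ge0 => z _; exact: F0.
apply: etrans (shiftP (mu 0%N) mg g0) _.
apply: eq_integral => x _; rewrite /g -ge0_integralZr.
- apply: eq_integral => z _; rewrite /F -muleA -EFinM; congr (_ * _%:E).
  rewrite dot_tcons big_ord_recl gauss_ratioD mulrC; congr (_ * gauss_ratio s V (dot _ _))%R.
  by apply: val_inj.
- exact: measurableT.
- exact: (measurable_tcons_section x mF).
- by move=> z _; exact: F0.
- by rewrite lee_fin expR_ge0.
Qed.

(** Each step of the induction merges the next coordinate into [y] by [addP]. The sign of [a] counts
    at the end, where the root of [a ^+ 2] must be [a]. *)
Lemma iid_dot (a : R) n (mu : nat -> R) (g : X -> \bar R) :
    (0 <= a)%R -> measurable_fun setT g -> (forall z, 0 <= g z) ->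
  \int[P]_y \int[iid P n]_z g (a * y + dot mu z)%R =
  \int[P]_y g (Num.sqrt (a ^+ 2 + \sum_(i < n) mu i ^+ 2) * y)%R.
Proof.
elim: n mu a => [|n IH] mu a a0 mg g0.
  apply: eq_integral => y _; rewrite iid_integral0//.
  by rewrite /dot !big_ord0 !addr0 sqrtr_sqr ger0_norm.
pose h (t : X) := \int[iid P n]_z g (t + dot (mu \o S) z)%R.
have mh : measurable_fun setT h.
  apply: (measurable_iid_integral P (F := fun tz : X * n.-tuple X => g (tz.1 + dot (mu \o S) tz.2)%R)).
    apply: (measurableT_comp mg); apply: measurable_funD => //.
    by apply: (measurableT_comp (@measurable_dot n _)).
  by move=> z; exact: g0.
have h0 t : 0 <= h t by apply: integral_ge0.
transitivity (\int[P]_y \int[P]_x h (a * y + mu 0%N * x)%R).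
  apply: eq_integral => y _.
  have mgy : measurable_fun setT (fun z : n.+1.-tuple X => g (a * y + dot mu z)%R).
    apply: (measurableT_comp mg); apply: measurable_funD; first exact: measurable_cst.
    exact: measurable_dot.
  rewrite (iid_integralS P mgy); last by move=> z; exact: g0.
  apply: eq_integral => x _; apply: eq_integral => z _.
  by rewrite dot_tcons addrA.
rewrite (addP _ _ mh h0) (IH (mu \o S) _ (sqrtr_ge0 _) mg g0).
apply: eq_integral => y _; rewrite sqr_sqrtr ?addr_ge0 ?sqr_ge0//.
by rewrite big_ord_recl addrA.
Qed.

(** With [q] the likelihood ratio, [f * q <= expR eps * f + max 0 (q - expR eps)] holds pointwise
    because [f] lies between 0 and 1. The last term does not involve [f], so only its integral
    remains to be bounded. *)
Lemma abstract_gaussian_mechanism (eps delta : R) n (mu : nat -> R) (f : n.-tuple X -> \bar R) :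
    \int[P]_y (Num.max 0 (gauss_ratio s 1 y - expR eps))%:E <= delta%:E -> (\sum_(i < n) mu i ^+ 2 <= 1)%R ->
    measurable_fun setT f -> (forall z, 0 <= f z <= 1) ->
  \int[iid P n]_z f (translate mu z) <=
  (expR eps)%:E * \int[iid P n]_z f z + delta%:E.
Proof.
move=> nl mu1 mf f01.
have f0 z : 0 <= f z by have /andP[] := f01 z.
rewrite iid_translate//.
set V := (\sum_(i < n) _)%R in mu1 *.
pose a := Num.sqrt (1 - V).
have a2 : (a ^+ 2 = 1 - V)%R by rewrite sqr_sqrtr// subr_ge0.
set I := \int[_]_z (_ * _).
have mfr : measurable_fun setT (fun z => f z * (gauss_ratio s V (dot mu z))%:E).
  apply: emeasurable_funM => //; apply/measurable_EFinP.
  by apply: (measurableT_comp (measurable_gauss_ratio s V)); exact: measurable_dot.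
have fr0 z : 0 <= f z * (gauss_ratio s V (dot mu z))%:E.
  by rewrite mule_ge0// lee_fin gauss_ratio_ge0.
have mga : measurable_fun setT (fun y : X => (gauss_ratio s (a ^+ 2) (a * y))%:E).
  apply/measurable_EFinP; apply: (measurableT_comp (measurable_gauss_ratio s _)).
  exact: measurable_funM.
(* [y] is an additional coordinate, shifted by [a]; the shift then has norm 1. *)
have -> : I = \int[P]_y \int[iid P n]_z (f z * (gauss_ratio s 1 (a * y + dot mu z))%:E).
  have R1 : \int[P]_y (gauss_ratio s (a ^+ 2) (a * y))%:E = 1.
    apply: etrans (etrans (esym (shiftP a (g := cst 1) (measurable_cst _) (fun=> lee01))) _).
      by apply: eq_integral => y _; rewrite mul1e.
    exact: integral_prob_cst.
  (* The factor in [y] is the density of a shifted law and has integral 1, so it may be inserted. *)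
  transitivity (\int[P]_y (I * (gauss_ratio s (a ^+ 2) (a * y))%:E)).
    rewrite ge0_integralZl//.
    - by rewrite R1 mule1.
    - by move=> y _; rewrite lee_fin gauss_ratio_ge0.
    - exact: integral_ge0.
  apply: eq_integral => y _; rewrite -ge0_integralZr//.
    apply: eq_integral => z _; rewrite -muleA -EFinM mulrC -gauss_ratioD a2.
    by rewrite subrK.
  by rewrite lee_fin gauss_ratio_ge0.
pose k (t : X) := (Num.max 0 (gauss_ratio s 1 t - expR eps))%:E.
have k0 t : 0 <= k t by rewrite lee_fin le_max lexx.
have mk : measurable_fun setT k.
  apply/measurable_EFinP; apply: measurable_maxr => //; apply: measurable_funB => //.
  exact: measurable_gauss_ratio.
have mE : measurable_fun setT (fun yz : X * n.-tuple X => (a * yz.1 + dot mu yz.2)%R).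
  apply: measurable_funD; first exact: measurable_funM.
  exact: (measurableT_comp (@measurable_dot n _)).
have mky : measurable_fun setT (fun yz : X * n.-tuple X => k (a * yz.1 + dot mu yz.2)%R).
  exact: (measurableT_comp mk mE).
have ky0 (yz : X * n.-tuple X) : 0 <= k (a * yz.1 + dot mu yz.2)%R by exact: k0.
have mEy (y : X) : measurable_fun setT (fun z : n.-tuple X => (a * y + dot mu z)%R).
  by apply: measurable_funD => //; exact: measurable_dot.
have mfg : measurable_fun setT
    (fun yz : X * n.-tuple X => f yz.2 * (gauss_ratio s 1 (a * yz.1 + dot mu yz.2))%:E).
  apply: emeasurable_funM; first exact: (measurableT_comp mf).
  by apply/measurable_EFinP; apply: (measurableT_comp (measurable_gauss_ratio s 1)).
have fg0 yz : 0 <= f yz.2 * (gauss_ratio s 1 (a * yz.1 + dot mu yz.2))%:E.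
  by rewrite mule_ge0// lee_fin gauss_ratio_ge0.
apply: (@le_trans _ _ (\int[P]_y ((expR eps)%:E * (\int[iid P n]_z f z) +
     \int[iid P n]_z k (a * y + dot mu z)%R))).
  apply: ge0_le_integral; first exact: measurableT.
  - by move=> y _; apply: integral_ge0 => z _; exact: (fg0 (y, z)).
  - exact: (measurable_iid_integral P mfg fg0).
  - apply: emeasurable_funD => //.
    exact: (measurable_iid_integral P mky ky0).
  - move=> y _; rewrite -ge0_integralZl// -ge0_integralD//; last 3 first.
    + by move=> z _; rewrite mule_ge0.
    + exact: emeasurable_funM.
    + exact: (measurableT_comp mk (mEy y)).
    apply: ge0_le_integral; first exact: measurableT.
    + by move=> z _; exact: (fg0 (y, z)).
    + apply: emeasurable_funM => //; apply/measurable_EFinP.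
      exact: (measurableT_comp (measurable_gauss_ratio s 1) (mEy y)).
    + apply: emeasurable_funD; first exact: emeasurable_funM.
      exact: (measurableT_comp mk (mEy y)).
    + move=> z _; move: (f01 z); case: (f z) => [r||] /andP[]// r0 r1.
      rewrite /k -!EFinM -EFinD lee_fin; set q := gauss_ratio _ _ _.
      rewrite !lee_fin in r0 r1.
      have [h|h] := leP 0%R (q - expR eps)%R; nra.
rewrite ge0_integralD//; last 3 first.
- by rewrite mule_ge0//; exact: integral_ge0.
- by move=> y _; apply: integral_ge0.
- exact: (measurable_iid_integral P mky ky0).
rewrite integral_prob_cst; apply: leeD; first exact: lexx.
rewrite (iid_dot n mu (sqrtr_ge0 _) mk k0) a2 subrK sqrtr1.
apply: le_trans nl; rewrite le_eqVlt; apply/orP; left; apply/eqP.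
by apply: eq_integral => y _; rewrite mul1r.
Qed.

End abstract_gauss.

(** The ratio exceeds [expR eps] exactly from [c] on. The integral is thus the mass of this
    half-line under the law shifted by 1, less [expR eps] times its mass under the centred law: the
    two terms in [gaussian_noise_level]. *)
Lemma gauss_excess (eps delta s : R) : gaussian_noise_level eps delta s ->
  \int[N s]_y (Num.max 0 (gauss_ratio s 1 y - expR eps))%:E <= delta%:E.
Proof.
move=> [sgt0 nl]; have s0 : s != 0%R by rewrite gt_eqF.
pose c := (s ^+ 2 * eps + 1 / 2)%R.
pose A : set X := `[c, +oo[%classic.
have mA : measurable A by exact: measurable_itv.
have m1A : measurable_fun setT (fun y : X => (\1_A y)%:E : \bar R) by exact: measurable_indicE mA.
have mk : measurable_fun setT (fun y : X => (Num.max 0 (gauss_ratio s 1 y - expR eps))%:E).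
  apply/measurable_EFinP; apply: measurable_maxr => //; apply: measurable_funB => //.
  exact: measurable_gauss_ratio.
have A0 (y : X) : 0 <= (\1_A y)%:E :> \bar R by rewrite lee_fin.
have ratioc y : (c <= y)%R = (expR eps <= gauss_ratio s 1 y)%R.
  rewrite /gauss_ratio ler_expR /c lerBrDr ler_pdivlMr ?exprn_gt0//.
  by congr (_ <= _)%R; field.
have e1 : \int[N s]_y (\1_A y)%:E = (Phi (- (2 * s)^-1 - eps * s))%:E.
  rewrite -(normal_prob_indic s mA) normal_prob_ge//; congr (Phi _)%:E.
  by rewrite /c; field.
have e2 : \int[N s]_y ((\1_A y)%:E * (gauss_ratio s 1 y)%:E) =
    (Phi ((2 * s)^-1 - eps * s))%:E.
  have := integral_normal_shift 1 s0 m1A A0.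
  rewrite expr1n; under [X in _ = X -> _]eq_integral do rewrite mul1r.
  move=> <-; pose B : set X := `[(c - 1)%R, +oo[%classic.
  have mB : measurable B by exact: measurable_itv.
  transitivity (\int[N s]_y (\1_B y)%:E).
    by apply: eq_integral => y _; rewrite !indicE /A /B !mem_setE !in_itv/= !andbT lerBlDr.
  rewrite -(normal_prob_indic s mB) normal_prob_ge//; congr (Phi _)%:E.
  by rewrite /c; field.
(* Adding the centred term instead of subtracting it keeps all integrands nonnegative. *)
have : \int[N s]_y ((Num.max 0 (gauss_ratio s 1 y - expR eps))%:E + (expR eps)%:E * (\1_A y)%:E)
   = \int[N s]_y ((\1_A y)%:E * (gauss_ratio s 1 y)%:E).
  apply: eq_integral => y _; rewrite -!EFinM -EFinD; congr EFin.
  rewrite indicE /A mem_setE in_itv/= andbT ratioc.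
  have [h|h] := leP (expR eps) (gauss_ratio s 1 y).
    by rewrite max_r ?subr_ge0// mulr1 mul1r subrK.
  by rewrite max_l ?subr_le0 ?ltW// mulr0 mul0r addr0.
have max0 (y : X) : setT y -> 0 <= (Num.max 0 (gauss_ratio s 1 y - expR eps))%:E.
  by move=> _; rewrite lee_fin le_max lexx.
have eA0 (y : X) : setT y -> 0 <= (expR eps)%:E * (\1_A y)%:E.
  by move=> _; rewrite mule_ge0// lee_fin ?expR_ge0.
have meA : measurable_fun setT (fun y : X => (expR eps)%:E * (\1_A y)%:E : \bar R).
  exact: emeasurable_funM.
rewrite (ge0_integralD (N s) measurableT max0 mk eA0 meA).
have ee0 : 0 <= (expR eps)%:E by rewrite lee_fin expR_ge0.
rewrite (ge0_integralZl (N s) measurableT m1A (fun y _ => A0 y) ee0).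
rewrite e1 e2 -EFinM; set I := (X in X + _ = _ -> X <= _).
by case: I => // r [rE]; rewrite lee_fin -(addrK (expR eps * Phi (- (2 * s)^-1 - eps * s))%R r) rE.
Qed.

Lemma gaussian_mechanism (eps delta s : R) n (mu : nat -> R) (f : n.-tuple X -> \bar R) :
    gaussian_noise_level eps delta s -> (\sum_(i < n) mu i ^+ 2 <= 1)%R ->
    measurable_fun setT f -> (forall z, 0 <= f z <= 1) ->
  \int[iid (N s) n]_z f (translate mu z) <=
  (expR eps)%:E * \int[iid (N s) n]_z f z + delta%:E.
Proof.
move=> nl mu1 mf f01; have s0 : s != 0%R by rewrite gt_eqF// nl.1.
apply: (@abstract_gaussian_mechanism (N s) s) => //.
- by move=> m g; exact: integral_normal_shift.
- by move=> a b g; exact: integral_normal_add.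
- exact: gauss_excess.
Qed.

End iid_gauss.

(** * Integrals of functions that need not be measurable *)

Section lower_integral.
Context d (T : measurableType d) (R : realType) (mu : {measure set T -> \bar R}).
Local Open Scope ereal_scope.
Import HBNNSimple.

(* Without measurability, the integral of a nonnegative function is the supremum
   of the integrals of the simple functions below it. *)
Lemma ge0_integral_le_simple (F : T -> \bar R) (c : \bar R) : (forall z, 0 <= F z) ->
  (forall h : {nnsfun T >-> R}, (forall z, (h z)%:E <= F z) ->
     \int[mu]_z (h z)%:E <= c) ->
  \int[mu]_z F z <= c.
Proof.
move=> F0 Hc; rewrite ge0_integralTE//.
by apply: ge_ereal_sup => _ [h /= hF <-]; rewrite -integralT_nnsfun; exact: Hc.
Qed.

Lemma ge0_le_lower_integral (F G : T -> \bar R) : (forall z, 0 <= F z) ->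
  (forall z, F z <= G z) -> \int[mu]_z F z <= \int[mu]_z G z.
Proof.
move=> F0 FG; have G0 z : 0 <= G z by exact: le_trans (F0 z) (FG z).
apply: ge0_integral_le_simple => // h hF; rewrite [leRHS]ge0_integralTE// integralT_nnsfun.
by apply: ereal_sup_ubound; exists h => // z; exact: le_trans (hF z) (FG z).
Qed.

End lower_integral.

Section iid_reindex.
Context d (T : measurableType d) (R : realType) (P : probability T R).
Local Open Scope ereal_scope.

Definition box n (B : nat -> set T) : set (n.-tuple T) :=
  [set z | forall i : 'I_n, B i (tnth z i)].

Arguments box n B : clear implicits.

Lemma measurable_box n (B : nat -> set T) : (forall i, measurable (B i)) ->
  measurable (box n B).
Proof.
move=> mB; have -> : box n B = \bigcap_(i in [set: 'I_n]) ((@tnth n T)^~ i @^-1` B i).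
  by apply/seteqP; split => z /= h i; [move=> _; exact: h | exact: h].
apply: fin_bigcap_measurable => // i _.
by rewrite -[X in measurable X]setTI; exact: (measurable_tnth i).
Qed.

Lemma iid_box n (B : nat -> set T) : (forall i, measurable (B i)) ->
  iid P n (box n B) = \prod_(i < n) P (B i).
Proof.
elim: n B => [|n IH] B mB.
  by rewrite big_ord0 /= diracE mem_set// => -[].
rewrite big_ord_recl -(IH (B \o S)) => [|i]; last exact: mB.
rewrite /= /distribution /pushforward -product_measure1E//; last first.
  by apply: measurable_box => i; exact: mB.
congr (_ _); apply/seteqP; split => -[x z] /=.
  move=> h; split; first exact: (h ord0).
  by move=> i; have := h (lift ord0 i); rewrite tnth_tconsS.
move=> [Bx Bz] i; case: (unliftP ord0 i) => [j|] ->; first by rewrite tnth_tconsS; exact: Bz.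
by rewrite tnth_tcons0.
Qed.

(** Boxes, unlike the cylinders that define this sigma-algebra, are stable under intersection, as
    the uniqueness theorem for measures requires. *)
Lemma measurable_tupleE n :
  (measurable : set (set (n.-tuple T))) =
  <<s [set A | exists2 B, (forall i, measurable (B i)) & A = box n B] >>.
Proof.
apply/seteqP; split.
  apply: smallest_sub; first exact: smallest_sigma_algebra.
  rewrite -bigcup_seq => A [i _ [C mC <-]]; apply: sub_sigma_algebra.
  exists (fun j => if j == i :> nat then C else setT).
    by move=> j; case: ifP.
  apply/seteqP; split => z /=; last by move=> /(_ i); rewrite eqxx.
  by move=> [_ Cz] j; case: eqP => // /val_inj ->.
apply: smallest_sub; first exact: sigma_algebra_measurable.
by move=> _ [B mB ->]; exact: measurable_box.
Qed.

Lemma integral_iid_reindex m n (rho : 'I_n -> 'I_m) (h : n.-tuple T -> \bar R) :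
  injective rho -> measurable_fun setT h -> (forall z, 0 <= h z) ->
  \int[iid P n]_z h z = \int[iid P m]_z h [tuple tnth z (rho i) | i < n].
Proof.
move=> rho_inj mh h0.
pose phi (z : m.-tuple T) := [tuple tnth z (rho i) | i < n].
have mphi : measurable_fun setT phi.
  apply/measurable_fun_tnthP => i.
  rewrite (_ : _ \o _ = (@tnth m T)^~ (rho i)); first exact: measurable_tnth.
  by apply/funext => z; rewrite /= tnth_mktuple.
pose phi' : {mfun m.-tuple T >-> n.-tuple T} :=
  HB.pack phi (isMeasurableFun.Build _ _ _ _ _ mphi).
rewrite -(ge0_integral_distribution (P := iid P m) phi' mh h0).
apply: (eq_measure_integral (distribution (iid P m) phi')) => A mA _.
apply: (@measure_unique _ _ _ _ (fun _ => setT) (measurable_tupleE n)) => //.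
- move=> _ _ [B mB ->] [C mC ->]; exists (fun i => B i `&` C i).
    by move=> i; exact: measurableI.
  apply/seteqP; split => z /=; first by move=> [Bz Cz] i; split.
  by move=> h'; split => i; have [] := h' i.
- by move=> _; exists (fun=> setT) => //; apply/seteqP; split.
- by apply/seteqP; split => // z _; exists 0%N.
- move=> _ [B mB ->].
  (* By injectivity [C k] is a single [B i] if [k] is the image of [i]. Off the image it is the
     whole space, whose factor is 1. *)
  pose C k := \bigcap_(i in [set i : 'I_n | rho i = k :> nat]) B i.
  have mC k : measurable (C k) by apply: fin_bigcap_measurable.
  transitivity (iid P m (box m C)); last first.
    rewrite /= /distribution /pushforward; congr (iid P m _); apply/seteqP; split => z /=.
      by move=> Cz i; rewrite tnth_mktuple; exact: (Cz (rho i) i erefl).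
    move=> Bz j i /= rij; have := Bz i; rewrite tnth_mktuple.
    by rewrite (val_inj rij).
  apply: etrans (iid_box n mB) _; apply: etrans _ (esym (iid_box m mC)).
  rewrite (bigID (mem (codom rho))) /= [X in _ * X]big1 ?mule1; last first.
    move=> j jr; have -> : C j = setT.
      apply/seteqP; split => // x _ i /= rij; move: jr.
      by rewrite -(val_inj rij) codom_f.
    exact: probability_setT.
  rewrite -big_uniq; last by rewrite /codom /image_mem map_inj_uniq ?enum_uniq.
  rewrite codomE big_map big_enum/=; apply: eq_big => // i _; congr (P _).
  apply/seteqP; split => x /=; last by move=> Cx; exact: (Cx i erefl).
  by move=> Bx i' /= /val_inj/rho_inj ->.
- by move=> _; apply: le_lt_trans (probability_le1 _ measurableT) _; rewrite ltry.
Qed.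

End iid_reindex.

(** * Noise attached to items *)

Section noise.
Context d (T : measurableType d) (R : realType) (P : probability T R).
Variables (I : eqType) (t0 : T).
Local Open Scope ereal_scope.
Import HBNNSimple.
Implicit Types (U : seq I) (F : (I -> T) -> \bar R).

Definition noise U (z : seq T) (i : I) : T := nth t0 z (index i U).

(** Noise is a function of the item rather than of its position, so that runs with different
    universes can be compared. *)
Definition noise_integral U F : \bar R := \int[iid P (size U)]_z F (noise U z).

Definition depends_on (U : pred I) {V : Type} (F : (I -> T) -> V) :=
  forall x y, {in U, x =1 y} -> F x = F y.

Lemma noise_default U (z : (size U).-tuple T) i : i \notin U -> noise U z i = t0.
Proof. by move=> iU; rewrite /noise nth_default// memNindex// size_tuple. Qed.

(** An inequality can be tested on simple functions below the left integrand; exchanging the two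
    lists gives the converse. *)
Lemma noise_integral_le_perm U U' F : uniq U -> perm_eq U U' -> (forall x, 0 <= F x) ->
  noise_integral U F <= noise_integral U' F.
Proof.
move=> uU UU' F0; apply: ge0_integral_le_simple => [z|h hF]; first exact: F0.
have idx (j : 'I_(size U)) : (index (tnth (in_tuple U) j) U' < size U')%N.
  by rewrite index_mem -(perm_mem UU') mem_tnth.
pose rho j := Ordinal (idx j).
have rho_inj : injective rho.
  move=> j k /(congr1 val)/= /(congr1 (nth (tnth (in_tuple U) j) U')).
  rewrite !nth_index -?(perm_mem UU') ?mem_tnth// => jk.
  exact: (elimT (tuple_uniqP (in_tuple U)) uU) jk.
rewrite (@integral_iid_reindex _ _ _ P _ _ _ (EFin \o h) rho_inj)//; last first.
- by move=> z; rewrite lee_fin.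
- exact/measurable_EFinP.
apply: ge0_le_lower_integral => [z|z]; first by rewrite lee_fin.
apply: le_trans (hF _) _; rewrite le_eqVlt; apply/orP; left; apply/eqP; congr F.
apply/funext => i; have [iU|iU] := boolP (i \in U); last first.
  by rewrite !noise_default// -(perm_mem UU').
have iU' : (index i U < size U)%N by rewrite index_mem.
rewrite /noise; set w := [tuple _ | _ < _].
have -> : nth t0 w (index i U) = tnth w (Ordinal iU') by rewrite (tnth_nth t0).
by rewrite tnth_mktuple (tnth_nth t0)/= (tnth_nth i)/= nth_index.
Qed.

Lemma noise_integral_cons i U F : i \notin U -> (forall x, 0 <= F x) ->
  depends_on (mem U) F -> noise_integral (i :: U) F = noise_integral U F.
Proof.
move=> iU F0 dF.
have nc (x : T) (z : (size U).-tuple T) : F (noise (i :: U) (tcons (x, z))) = F (noise U z).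
  apply: dF => j; rewrite inE => jU; rewrite /noise /=.
  by case: eqP => [ij|//]; move: iU; rewrite ij jU.
apply/eqP; rewrite eq_le; apply/andP; split; apply: ge0_integral_le_simple => [z|h hF]; rewrite ?F0//.
- have mh : measurable_fun setT (EFin \o h) by exact/measurable_EFinP.
  have h0 z : 0 <= (h z)%:E by rewrite lee_fin.
  apply: le_trans (_ : \int[P]_x \int[iid P (size U)]_z (h (tcons (x, z)))%:E <= _).
    by rewrite (iid_integralS P mh h0) lexx.
  rewrite (@fubini_tonelli _ _ _ _ _ P (iid P (size U)) ((EFin \o h) \o @tcons _ T (size U))
    (measurableT_comp mh (@measurable_tcons _ T (size U))) (fun z => h0 _)).
  apply: ge0_le_lower_integral => z; first by apply: integral_ge0 => x _; exact: h0.
  rewrite -(integral_prob_cst P (F (noise U z))).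
  apply: ge0_le_lower_integral => x; first exact: h0.
  by rewrite -(nc x z); exact: hF.
- have mh : measurable_fun setT (EFin \o h) by exact/measurable_EFinP.
  have h0 z : 0 <= (h z)%:E by rewrite lee_fin.
  pose hb (z : (size U).+1.-tuple T) := (h [tuple of behead z])%:E.
  have mhb : measurable_fun setT hb by apply: (measurableT_comp mh); exact: measurable_behead.
  have hb0 z : 0 <= hb z by rewrite lee_fin.
  have E x z : hb (tcons (x, z)) = (h z)%:E.
    by rewrite /hb; congr (h _)%:E; apply: val_inj.
  rewrite -(integral_prob_cst P (\int[_]_z _)).
  apply: (@le_trans _ _ (\int[iid P (size U).+1]_z hb z)).
    rewrite (iid_integralS P mhb hb0); apply: ge0_le_lower_integral => x.
      by apply: integral_ge0.
    by apply: ge0_le_lower_integral => // z; rewrite E.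
  apply: ge0_le_lower_integral => // -[s ss]; case: s ss => // x s ss.
  have ss' : size s == size U by [].
  have -> : Tuple ss = tcons (x, Tuple ss') by apply: val_inj.
  by rewrite nc E; exact: hF.
Qed.

Lemma noise_integral_cat U' U F : uniq (U' ++ U) -> (forall x, 0 <= F x) ->
  depends_on (mem U) F -> noise_integral (U' ++ U) F = noise_integral U F.
Proof.
move=> + F0 dF; elim: U' => //= i U' IH /andP[iU uU].
rewrite noise_integral_cons ?IH// => x y xy; apply: dF => j jU; apply: xy.
by rewrite inE mem_cat; apply/orP; right.
Qed.

Lemma noise_integral_sub U U' F : uniq U -> uniq U' -> {subset U <= U'} ->
  (forall x, 0 <= F x) -> depends_on (mem U) F ->
  noise_integral U' F = noise_integral U F.
Proof.
move=> uU uU' UU' F0 dF.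
pose V := [seq i <- U' | i \notin U] ++ U.
have uV : uniq V.
  rewrite cat_uniq filter_uniq//= uU andbT; apply/hasPn => i iU.
  by rewrite mem_filter iU.
have VU' : perm_eq V U'.
  apply: uniq_perm => // i; rewrite mem_cat mem_filter.
  by case: (boolP (i \in U)) => [/UU' ->|]; rewrite ?orbT ?orbF.
rewrite -(noise_integral_cat uV F0 dF); apply/eqP; rewrite eq_le.
by rewrite !noise_integral_le_perm// perm_sym.
Qed.

End noise.

(** * One noisy round and its continuation *)

Section transfer.
Context {R : realType} {I : eqType}.
Local Open Scope ereal_scope.
Import HBNNSimple.
Local Notation X := (measurableTypeR R).
Local Notation N s := (normal_prob (0 : R)%R s).
Implicit Types (U V : seq I) (w : I -> R).

Lemma measurable_noise U n i :
  measurable_fun setT (fun z : n.-tuple X => noise (0%R : X) U z i : X).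
Proof.
have [iU|iU] := ltnP (index i U) n; last first.
  rewrite (_ : (fun _ => _) = cst 0%R); first exact: measurable_cst.
  by apply/funext => z; rewrite /noise nth_default// size_tuple.
rewrite (_ : (fun _ => _) = (@tnth n X)^~ (Ordinal iU)); first exact: measurable_tnth.
by apply/funext => z; rewrite (tnth_nth 0%R).
Qed.

Definition below n U V w (rho : R) : set (n.-tuple X) :=
  [set z | forall i, i \in V -> (w i + noise (0%R : X) U z i < rho)%R].

Lemma measurable_below n U V w rho : measurable (@below n U V w rho).
Proof.
elim: V => [|i V IH].
  by have -> : @below n U [::] w rho = setT by apply/seteqP; split.
have -> : @below n U (i :: V) w rho =
    (fun z : n.-tuple X => noise (0%R : X) U z i : X) @^-1` `]-oo, (rho - w i)%R[ `&` @below n U V w rho.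
  apply/seteqP; split => z /=.
    move=> h; split; first by rewrite in_itv/= ltrBrDl h// mem_head.
    by move=> j jV; apply: h; rewrite inE jV orbT.
  move=> [zi zV] j; rewrite inE => /orP[/eqP ->|]; last exact: zV.
  by move: zi; rewrite in_itv/= ltrBrDl.
apply: measurableI => //; rewrite -[X in measurable X]setTI.
by apply: measurable_noise => //; exact: measurable_itv.
Qed.

Lemma noise_translate U (mu : I -> R) (z : (size U).-tuple X) i : i \in U ->
  noise (0%R : X) U (translate (nth 0%R (map mu U)) z) i = (noise (0%R : X) U z i + mu i)%R.
Proof.
move=> iU; have iU' : (index i U < size U)%N by rewrite index_mem.
rewrite /noise; set w := translate _ _.
have -> : nth 0%R w (index i U) = tnth w (Ordinal iU') by rewrite (tnth_nth 0%R).
by rewrite tnth_mktuple (tnth_nth 0%R)/= (nth_map i)// nth_index.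
Qed.

(** Here [f] and [g] are the probabilities of the event in the continuations of the two runs, as
    functions of the noisy weights. They are comparable only while the items of [V] stay below
    [rho]. *)
Lemma gaussian_transfer (s eps delta eps2 delta2 delta' rho : R) U V w w'
    (f g : (I -> R) -> \bar R) :
  gaussian_noise_level eps delta s -> uniq U -> {subset V <= U} ->
  (\sum_(i <- U) (w i - w' i) ^+ 2 <= 1)%R ->
  (forall x, 0 <= f x <= 1) -> (forall x, 0 <= g x) -> depends_on (mem U) g ->
  (0 <= delta2)%R ->
  (forall x, (forall i, i \in V -> (x i < rho)%R) ->
    f x <= (expR eps2)%:E * g x + delta2%:E) ->
  iid (N s) (size U) (~` below U V w rho) <= delta'%:E ->
  noise_integral (N s) (0%R : X) U (fun x => f (fun i => w i + x i)%R) <=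
  (expR (eps + eps2))%:E * noise_integral (N s) (0%R : X) U (fun x => g (fun i => w' i + x i)%R)
  + (delta + delta2 + delta')%:E.
Proof.
move=> nl uU VU ww' f01 g0 dg d2 fg bad.
pose n := size U.
pose W v (z : n.-tuple X) i := (v i + noise (0%R : X) U z i)%R.
apply: ge0_integral_le_simple => [z|h hF]; first by have /andP[] := f01 (W w z).
have h1 z : (h z <= 1)%R by rewrite -lee_fin (le_trans (hF z))//; have /andP[] := f01 (W w z).
pose G := @below n U V w rho.
have mG : measurable G by exact: measurable_below.
(* A measurable test function with values between 0 and 1, from which both the failure event and
   [delta2] are already removed; what remains is below [expR eps2 * g]. *)
pose k (z : n.-tuple X) := ((\1_G z) * Num.max 0 (h z - delta2))%R%:E.
have k0 z : 0 <= k z by rewrite lee_fin mulr_ge0// le_max lexx.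
have k1 z : k z <= 1.
  rewrite lee_fin indicE; case: (z \in G) => /=; last by rewrite mul0r.
  by rewrite mul1r ge_max ler01/= lerBlDr ler_wpDr.
have mk : measurable_fun setT k.
  apply/measurable_EFinP; apply: measurable_funM; first exact: measurable_indic.
  by apply: measurable_maxr => //; exact: measurable_funB.
pose nu := (fun i => w i - w' i)%R.
pose tau (z : n.-tuple X) := translate (nth 0%R (map nu U)) z.
(* [tau' z] is the noise that gives with [w] the noisy weights that [z] gives with [w']. The
   mechanism is applied to [k \o tau'], whose translate is [k]. *)
pose tau' (z : n.-tuple X) := translate (nth 0%R (map (fun i => - nu i)%R U)) z.
have tauK (z : n.-tuple X) : tau' (tau z) = z.
  apply: eq_from_tnth => j; rewrite !tnth_mktuple.
  pose i0 := tnth (in_tuple U) j.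
  by rewrite !(nth_map i0)// addrK.
have Wtau z i : i \in U -> W w (tau' z) i = W w' z i.
  by move=> iU; rewrite /W /tau' noise_translate// /nu; ring.
have mkt : measurable_fun setT (k \o tau').
  by apply: (measurableT_comp mk); exact: measurable_translate.
have sq : (\sum_(j < n) nth 0 (map nu U) j ^+ 2 <= 1)%R.
  apply: le_trans ww'; rewrite -(big_map nu predT (fun x => x ^+ 2)%R) (big_nth 0%R).
  by rewrite big_mkord size_map.
have gm : \int[iid (N s) n]_z k z <=
    (expR eps)%:E * \int[iid (N s) n]_z (k \o tau') z + delta%:E.
  apply: le_trans (gaussian_mechanism nl sq mkt (fun z => introT andP (conj (k0 _) (k1 _)))).
  by rewrite le_eqVlt; apply/orP; left; apply/eqP; apply: eq_integral => z _; rewrite -[in LHS](tauK z).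
have kg : \int[iid (N s) n]_z (k \o tau') z <=
    (expR eps2)%:E * noise_integral (N s) (0%R : X) U (fun x => g (fun i => w' i + x i)%R).
  have e0 : (0 < expR eps2)%R by exact: expR_gt0.
  have ei0 : 0 <= ((expR eps2)^-1)%:E by rewrite lee_fin invr_ge0 expR_ge0.
  rewrite -lee_pdivrMl// -(ge0_integralZl _ measurableT mkt (fun z _ => k0 _) ei0).
  apply: ge0_le_lower_integral => z.
    by apply: mule_ge0 => //; exact: k0.
  rewrite lee_pdivrMl//= /k indicE; have [zG|_] := boolP (tau' z \in G); last first.
    by rewrite mul0r mule_ge0// lee_fin expR_ge0.
  rewrite mul1r; have -> : g (fun i => w' i + noise (0%R : X) U z i)%R = g (W w (tau' z)).
    by apply: dg => i iU; rewrite Wtau.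
  have := le_trans (hF (tau' z)) (fg (W w (tau' z)) _).
  move=> /(_ (set_mem zG)).
  rewrite -leeBlDr// EFin_max ge_max => ->; rewrite andbT.
  by rewrite mule_ge0// lee_fin expR_ge0.
apply: (@le_trans _ _ (\int[iid (N s) n]_z k z + delta2%:E + delta'%:E)).
  apply: (@le_trans _ _ (\int[iid (N s) n]_z (k z + delta2%:E + (\1_(~` G) z)%:E))).
    apply: ge0_le_lower_integral => z; first by rewrite lee_fin.
    rewrite -!EFinD lee_fin !indicE in_setC; case: (z \in G) => /=.
      by rewrite mul1r addr0 -lerBlDr le_max lexx orbT.
    by rewrite mul0r add0r ler_wpDl.
  have md2 : measurable_fun setT (fun z : n.-tuple X => k z + delta2%:E).
    exact: emeasurable_funD.
  have mC : measurable_fun setT (fun z : n.-tuple X => (\1_(~` G) z)%:E : \bar R).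
    by apply/measurable_EFinP; apply: measurable_indic; exact: measurableC.
  have kd0 (z : n.-tuple X) : setT z -> 0 <= k z + delta2%:E.
    by move=> _; rewrite adde_ge0// lee_fin.
  have C0 (z : n.-tuple X) : setT z -> 0 <= (\1_(~` G) z)%:E :> \bar R.
    by move=> _; rewrite lee_fin.
  rewrite (ge0_integralD _ measurableT kd0 md2 C0 mC); apply: leeD.
    rewrite (ge0_integralD _ measurableT (fun z _ => k0 z) mk) ?integral_prob_cst//.
  apply: le_trans bad; rewrite le_eqVlt; apply/orP; left; apply/eqP.
  by apply: etrans (integral_indic _ measurableT (measurableC mG)) _; rewrite setIT.
apply: (@le_trans _ _ ((expR eps)%:E * \int[iid (N s) n]_z (k \o tau') z + delta%:E + delta2%:E + delta'%:E)).
  by rewrite !leeD2r.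
rewrite -!addeA; apply: leeD; last by rewrite -!EFinD addrA.
rewrite expRD EFinM -muleA lee_pmul2l// ?lte_fin ?expR_gt0//.
Qed.

End transfer.

(** * Thresholds and novel items *)

Section novel_items.
Context {R : realType} {I : eqType}.
Local Notation X := (measurableTypeR R).
Local Notation N s := (normal_prob (0 : R) s).
Implicit Types (U V : seq I) (w : I -> R).

Lemma threshold_ge_term (bmax s delta : R) Delta0 t : (0 < t <= Delta0)%N ->
  bmax / Num.sqrt t%:R + s * Phi_inv ((1 - delta / 2) `^ (t%:R^-1)) <=
  threshold bmax s delta Delta0.
Proof.
move=> tD.
pose F t := bmax / Num.sqrt t%:R + s * Phi_inv ((1 - delta / 2) `^ (t%:R^-1)).
apply: (le_bigmax_seq (F 1%N) t predT F) => //.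
by rewrite mem_index_iota ltnS.
Qed.

(** The term [t = 1] of the maximum suffices: its quantile is taken at [1 - delta / 2], which is
    above [1 / 2]. *)
Lemma threshold_ge (bmax s delta : R) Delta0 : 0 < s -> 0 < delta < 1 ->
  (0 < Delta0)%N -> bmax <= threshold bmax s delta Delta0.
Proof.
move=> s0 /andP[d0 d1] D0.
apply: le_trans (@threshold_ge_term bmax s delta Delta0 1%N D0).
rewrite sqrtr1 divr1 invr1 powRr1; last by lra.
rewrite lerDl; apply: mulr_ge0; first exact: ltW.
by apply: Phi_inv_ge0; apply/andP; split; lra.
Qed.

(** With [t] items, term [t] of the threshold keeps each of them below it with probability at least
    [c], the [t]-th root of [1 - delta / 2]. By independence all stay below with probability at
    least [c ^+ t]. *)
Lemma prob_novel_item_above (s delta bmax : R) Delta0 U V w :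
  0 < s -> 0 < delta < 1 -> uniq U -> uniq V -> {subset V <= U} ->
  (size V <= Delta0)%N -> {in V, forall i, w i <= bmax / Num.sqrt (size V)%:R} ->
  (iid (N s) (size U) (~` below U V w (threshold bmax s delta Delta0)) <= (delta / 2)%:E)%E.
Proof.
move=> s0 /andP[d0 d1] uU uV VU VD wV.
set rho := threshold _ _ _ _.
(* The maximum in [threshold] starts at 1, so the case of no item is separate. *)
have [V0|t0] := posnP (size V).
  have -> : @below _ _ (size U) U V w rho = setT.
    by apply/seteqP; split => // z _ i; rewrite (size0nil V0).
  by rewrite setCT measure0 lee_fin; lra.
have [i0 i0V] : {i | i \in V} by case: (V) t0 => // i V' _; exists i; rewrite mem_head.
pose q := 1 - delta / 2.
pose c := q `^ ((size V)%:R^-1).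
have q0 : 0 < q by rewrite /q; lra.
have q1 : q < 1 by rewrite /q; lra.
have r0 : 0 < (size V)%:R^-1 :> R by rewrite invr_gt0 ltr0n.
have c01 : 0 < c < 1.
  have : q `^ ((size V)%:R^-1) < 1 `^ ((size V)%:R^-1).
    by apply: (gt0_ltr_powR r0) => //; rewrite nnegrE ?ler01// ltW.
  by rewrite powR1 -/c => ->; rewrite powR_gt0.
have cq : c ^+ size V = q.
  rewrite -powR_mulrn ?powR_ge0// -powRrM mulVf ?powRr1 ?ltW//.
  by rewrite pnatr_eq0 -lt0n.
have cphi i : i \in V -> c <= Phi ((rho - w i) / s).
  move=> iV; rewrite -(Phi_invK c01); apply: Phi_le.
  rewrite ler_pdivlMr// lerBrDl mulrC.
  have tD : (0 < size V <= Delta0)%N by rewrite t0.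
  have := @threshold_ge_term bmax s delta Delta0 _ tD.
  by have := wV i iV; rewrite -/rho -/q -/c; lra.
pose B k : set X := if nth i0 U k \in V then `]-oo, (rho - w (nth i0 U k))[%classic else setT.
have mB k : measurable (B k) by rewrite /B; case: ifP => _; [exact: measurable_itv|exact: measurableT].
have belowE : @below _ _ (size U) U V w rho = @box _ X (size U) B.
  apply/seteqP; split => z /= h.
    move=> k; rewrite /B; case: ifPn => // kV.
    rewrite /= in_itv/= ltrBrDl; have := h _ kV.
    by rewrite /noise index_uniq// (tnth_nth 0).
  move=> i iV; have iU : (index i U < size U)%N by rewrite index_mem VU.
  have := h (Ordinal iU); rewrite /B /= nth_index ?VU// iV /= in_itv/= ltrBrDl.
  by rewrite (tnth_nth 0).
have qle : (q%:E <= iid (N s) (size U) (below U V w rho))%E.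
  rewrite belowE; apply: le_trans (_ : (_ <= \prod_(k < size U) N s (B k))%E) _; last first.
    by have /= -> := iid_box (N s) (size U) mB; exact: lexx.
  pose p i : R := if i \in V then Phi ((rho - w i) / s) else 1.
  have pB (k : 'I_(size U)) : N s (B k) = (p (nth i0 U k))%:E.
    rewrite /B /p; case: ifP => _; first exact: normal_prob_lt.
    exact: probability_setT.
  under eq_bigr do rewrite pB.
  rewrite prodEFin lee_fin -(big_mkord predT (fun k => p (nth i0 U k))) -(big_nth i0 predT p).
  rewrite /p -big_mkcond/= -cq.
  have -> : c ^+ size V = \prod_(i <- U | i \in V) c.
    rewrite big_const_seq iter_mulr_1; congr (_ ^+ _).
    rewrite -size_filter; apply/perm_size/uniq_perm; rewrite ?filter_uniq// => i.
    by rewrite mem_filter; case: (boolP (i \in V)) => // /VU ->.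
  apply: ler_prod => i iV; rewrite cphi// andbT.
  by have /andP[/ltW] := c01.
have mb : measurable (@below _ _ (size U) U V w rho) by exact: measurable_below.
have := probability_setC (iid (N s) (size U)) mb => /= ->.
rewrite leeBlDr ?fin_num_measure//; apply: le_trans (_ : ((delta / 2)%:E + q%:E <= _)%E).
  by rewrite -EFinD lee_fin /q; lra.
by rewrite leeD2l.
Qed.

End novel_items.

(** * The weights *)

Section weights.
Context {Sigma : choiceType} {R : realType}.
Local Open Scope fset_scope.
Local Open Scope ring_scope.
Implicit Types (A : {fset Sigma}) (b w : Sigma -> R) (bmin bmax : R).

(** A loop that never exits returns its initial value, which satisfies [Q] as well. *)
Lemma while_inv (T : Type) (Q : T -> Prop) (c : T -> bool) (f : T -> T) x :
  Q x -> (forall y, Q y -> Q (f y)) -> Q (while c f x).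
Proof.
move=> Qx Qf; rewrite /while; case: pselect => // h.
by elim: (ex_minn h) => //= n; exact: Qf.
Qed.

Lemma sum_fsub A B (F : Sigma -> R) : B `<=` A ->
  \sum_(i <- A | i \in B) F i = \sum_(i <- B) F i.
Proof.
move=> /fsubsetP BA; rewrite -big_filter; apply: perm_big.
apply: uniq_perm; rewrite ?filter_uniq ?fset_uniq// => i.
by rewrite mem_filter; case: (boolP (i \in B)) => //= /BA.
Qed.

Lemma fset_sum_const A (c : R) : \sum_(i <- A) c = #|` A|%:R * c.
Proof. by rewrite big_const_seq count_predT iter_addr_0 mulr_natl. Qed.

(** The lower bound controls the effect of truncation, the upper bound the weight of novel items,
    and the norm bound the sensitivity. *)
Definition weights_ok A bmin bmax w :=
  (forall i, i \in A -> bmin / Num.sqrt #|` A|%:R <= w i <= bmax / Num.sqrt #|` A|%:R)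
  /\ sq_norm A w <= 1.

Section fixed_user.
Variables (A : {fset Sigma}) (b : Sigma -> R) (bmin bmax : R).
Hypotheses (bmin_gt0 : 0 < bmin) (bmin_le1 : bmin <= 1) (bmax_ge1 : 1 <= bmax).
Hypothesis A_gt0 : (0 < #|` A|)%N.
Let d : R := #|` A|%:R.
Let d_gt0 : 0 < d. Proof. by rewrite ltr0n. Qed.
Let sd_gt0 : 0 < Num.sqrt d. Proof. by rewrite sqrtr_gt0. Qed.
Let sd2 : (Num.sqrt d)^-1 ^+ 2 = d^-1. Proof. by rewrite exprVn sqr_sqrtr// ltW. Qed.

Lemma biased_weight_bounds i : i \in biased A b ->
  bmin / Num.sqrt d <= biased_weight A b bmin i <= (Num.sqrt d)^-1.
Proof.
rewrite !inE/= => /andP[_ bi]; rewrite /biased_weight -/d.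
rewrite ler_pM2r ?invr_gt0// le_max lexx/= ler_pdivrMr// mulVf ?gt_eqF//.
by rewrite ge_max bmin_le1 ltW.
Qed.

Lemma biased_sq_sum : \sum_(j <- biased A b) biased_weight A b bmin j ^+ 2 <=
  #|` biased A b|%:R / d.
Proof.
rewrite -fset_sum_const big_seq [leRHS]big_seq; apply: ler_sum => i iB.
have /andP[l u] := biased_weight_bounds iB.
rewrite -sd2; apply: lerXn2r => //; rewrite nnegrE ?invr_ge0 ?ltW//.
by apply: lt_le_trans l; rewrite divr_gt0.
Qed.

Lemma card_biasedD : #|` biased A b|%:R + #|` unbiased A b|%:R = d.
Proof.
have : biased A b `<=` A by apply/fsubsetP => i; rewrite !inE => /andP[].
move=> /fsetIidPr Ab; rewrite /d -(cardfsID (biased A b) A) natrD Ab //.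
Qed.

(** A biased item uses at most [1 / d] of the squared norm, so an equal share of the rest gives each
    unbiased item at least [1 / d]. *)
Lemma initial_weights_ok : weights_ok A bmin bmax (initial_weights A b bmin bmax).
Proof.
set sb := \sum_(j <- biased A b) biased_weight A b bmin j ^+ 2.
have sbd : sb <= #|` biased A b|%:R / d by exact: biased_sq_sum.
have unb i : i \in A -> i \notin biased A b -> (0 < #|` unbiased A b|)%N.
  by move=> iA ib; rewrite cardfs_gt0; apply/fset0Pn; exists i; rewrite in_fsetD ib.
have ubd i : i \in A -> i \notin biased A b -> d^-1 <= (1 - sb) / #|` unbiased A b|%:R.
  move=> iA ib; rewrite ler_pdivlMr ?ltr0n ?(unb i)//.
  apply: (@le_trans _ _ (1 - #|` biased A b|%:R / d)); last by rewrite lerD2l lerN2.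
  have -> : #|` unbiased A b|%:R = d - #|` biased A b|%:R by rewrite -card_biasedD addrC addKr.
  by rewrite mulrBr mulVf ?gt_eqF// mulrC.
split.
  move=> i iA; rewrite /initial_weights iA/=.
  case: ifPn => [ib|ib].
    have /andP[-> u] := biased_weight_bounds ib; rewrite /=.
    by apply: (le_trans u); rewrite ler_pdivlMr// mulVf ?gt_eqF.
  rewrite ge_min lexx andbT le_min -/d -/sb ler_pM2r ?invr_gt0// (le_trans bmin_le1)//=.
  apply: (@le_trans _ _ (Num.sqrt d^-1)); last exact/ler_wsqrtr/(ubd i).
  by rewrite sqrtrV; [rewrite ler_pdivrMr// mulVf ?gt_eqF|exact: ltW].
have ub_ge0 : 0 <= (1 - sb) / #|` unbiased A b|%:R.
  rewrite divr_ge0// subr_ge0 (le_trans sbd)// ler_pdivrMr// mul1r.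
  by rewrite -card_biasedD lerDl.
have biasedA : biased A b `<=` A by apply/fsubsetP => i; rewrite !inE => /andP[].
rewrite /sq_norm (bigID (mem (biased A b)))/= (sum_fsub _ biasedA).
have -> : \sum_(i <- biased A b) initial_weights A b bmin bmax i ^+ 2 = sb.
  rewrite big_seq /sb [RHS]big_seq; apply: eq_bigr => i ib.
  by rewrite /initial_weights ib (fsubsetP biasedA i ib).
rewrite addrC -lerBrDr.
apply: (@le_trans _ _ (#|` unbiased A b|%:R * ((1 - sb) / #|` unbiased A b|%:R))).
  rewrite -fset_sum_const -[leRHS](@sum_fsub A); last exact: fsubsetDl.
  rewrite big_seq_cond [leRHS]big_seq_cond.
  rewrite (eq_bigl (fun i => (i \in A) && (i \in unbiased A b))) => [|i]; last first.
    by rewrite in_fsetD; case: (i \in A); rewrite ?andbT ?andbF.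
  apply: ler_sum => i; rewrite in_fsetD => /andP[iA /andP[ib _]].
  rewrite /initial_weights iA (negbTE ib)/= -/d -/sb -[leRHS]sqr_sqrtr//.
  apply: lerXn2r; rewrite ?nnegrE ?sqrtr_ge0// ?ge_min ?lexx ?orbT//.
  by rewrite le_min sqrtr_ge0 divr_ge0// ?ltW// (lt_le_trans _ bmax_ge1).
(* Without unbiased items the share is a division by zero, hence 0. *)
have [->|u0] := eqVneq (#|` unbiased A b|%:R : R) 0.
  rewrite mul0r subr_ge0 (le_trans sbd)// ler_pdivrMr// mul1r.
  by rewrite -card_biasedD lerDl.
by rewrite mulrC divfK.
Qed.

(** Both terms of the minimum are at least 1, which preserves the lower bound. The first keeps the
    largest small weight below [bmax / sqrt d]; the second is the factor that would make the norm
    exactly 1. *)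
Lemma rescale_small_ok w : weights_ok A bmin bmax w ->
  weights_ok A bmin bmax (rescale_small A bmax w).
Proof.
move=> [wb wn].
have w0 i : i \in A -> 0 < w i.
  by move=> iA; have /andP[h _] := wb i iA; apply: lt_le_trans h; rewrite divr_gt0.
have sA i : i \in small A w -> i \in A by rewrite !inE => /andP[].
have ssd i : i \in small A w -> w i < (Num.sqrt d)^-1 by rewrite !inE => /andP[].
have [S0|[i0 i0s]] := fset_0Vmem (small A w).
  have -> : rescale_small A bmax w = w; last by split.
  by apply/funext => i; rewrite /rescale_small S0 inE.
pose M := \big[Num.max/0]_(i <- small A w) w i.
have wM i : i \in small A w -> w i <= M by move=> iS; exact: (le_bigmax_seq 0 i predT w).
have M0 : 0 < M by apply: lt_le_trans (wM _ i0s); exact/w0/sA.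
have Msd : M <= (Num.sqrt d)^-1.
  rewrite /M big_seq; apply: bigmax_le; first by rewrite invr_ge0 ltW.
  by move=> i iS; exact/ltW/ssd.
pose Ns := \sum_(i <- small A w) w i ^+ 2.
have Ns0 : 0 < Ns.
  rewrite /Ns (big_fsetD1 i0)//= ltr_pwDl ?exprn_gt0 ?w0 ?sA//.
  by apply: sumr_ge0 => i _; exact: sqr_ge0.
pose C := rescaling A bmax w.
have C1 : 1 <= C.
  rewrite /C /rescaling le_min -/M -/Ns -/d; apply/andP; split.
    rewrite ler_pdivlMr// mul1r; apply: (le_trans Msd).
    by rewrite ler_pdivlMr// mulVf ?gt_eqF.
  rewrite -[leLHS]sqrtr1; apply: ler_wsqrtr.
  by rewrite lerDl divr_ge0// ?subr_ge0// ltW.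
have CM : C * M <= bmax / Num.sqrt d.
  by rewrite -ler_pdivlMr// /C /rescaling ge_min lexx.
have CN : C ^+ 2 * Ns <= Ns + (1 - sq_norm A w).
  rewrite -ler_pdivlMr// mulrDl divff ?gt_eqF//.
  have q0 : 0 <= 1 + (1 - sq_norm A w) / Ns.
    by rewrite addr_ge0// divr_ge0// ?subr_ge0// ltW.
  rewrite -[leRHS]sqr_sqrtr//; apply: lerXn2r; rewrite ?nnegrE ?sqrtr_ge0//.
    exact: le_trans C1.
  by rewrite /C /rescaling ge_min lexx orbT.
split.
- move=> i iA; rewrite /rescale_small -/C; case: ifPn => [iS|_]; last exact: wb.
  have /andP[l u] := wb i iA; apply/andP; split.
    by apply: (le_trans l); rewrite ler_peMl// ltW// w0.
  by apply: le_trans CM; rewrite ler_pM2l ?wM// (lt_le_trans _ C1).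
- have smallA : small A w `<=` A by apply/fsubsetP.
  have NE : sq_norm A w = Ns + \sum_(i <- A | i \notin small A w) w i ^+ 2.
    by rewrite /sq_norm (bigID (mem (small A w)))/= (sum_fsub _ smallA).
  rewrite /sq_norm (bigID (mem (small A w)))/= (sum_fsub _ smallA).
  have -> : \sum_(i <- small A w) rescale_small A bmax w i ^+ 2 = C ^+ 2 * Ns.
    rewrite mulr_sumr big_seq [RHS]big_seq; apply: eq_bigr => i iS.
    by rewrite /rescale_small iS exprMn.
  rewrite (eq_bigr (fun i => w i ^+ 2)) => [|i iS]; last first.
    by rewrite /rescale_small (negbTE iS).
  by move: CN; rewrite NE; lra.
Qed.

Lemma user_weights_ok : weights_ok A bmin bmax (user_weights A b bmin bmax).
Proof.
apply: while_inv; first exact: initial_weights_ok.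
exact: rescale_small_ok.
Qed.

End fixed_user.

Lemma user_weights_ext A b b' bmin bmax : {in A, b =1 b'} ->
  user_weights A b bmin bmax = user_weights A b' bmin bmax.
Proof.
move=> bb'; rewrite /user_weights; congr (while _ _ _).
have bE : biased A b = biased A b'.
  by apply/fsetP => i; rewrite !inE/=; case: (boolP (i \in A)) => //= /bb' ->.
apply/funext => i; rewrite /initial_weights /unbiased bE.
case: ifPn => //; rewrite negbK => iA; rewrite /biased_weight bb'//.
case: ifP => // _; congr (Num.min _ (Num.sqrt ((1 - _) / _))).
rewrite !big_seq; apply: eq_bigr => j; rewrite !inE => /andP[jA _].
by rewrite bb'.
Qed.

End weights.

(** * Triangle inequality for the l2-norm *)

Section l2_bound.
Context {I : eqType} {R : realType}.
Implicit Types (U : seq I) (f g : I -> R).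

Definition l2_bound U f (a : R) := 0 <= a /\ \sum_(i <- U) f i ^+ 2 <= a ^+ 2.

Lemma l2_boundD U f g a b : l2_bound U f a -> l2_bound U g b ->
  l2_bound U (fun i => f i + g i) (a + b).
Proof.
move=> [a0 fa] [b0 gb]; split; first exact: addr_ge0.
have zero (h : I -> R) (c : R) : c = 0 -> \sum_(i <- U) h i ^+ 2 <= c ^+ 2 -> {in U, forall i, h i = 0}.
  move=> -> hc i iU; have : \sum_(i <- U) h i ^+ 2 == 0.
    rewrite eq_le; apply/andP; split; first by apply: (le_trans hc); rewrite expr0n.
    by apply: sumr_ge0 => j _; exact: sqr_ge0.
  rewrite psumr_eq0 => [/allP/(_ i iU)/=|j _]; last exact: sqr_ge0.
  by rewrite sqrf_eq0 => /eqP.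
(* Zero bounds are set apart because the general argument divides by [a] and [b]. *)
have [a00|an0] := eqVneq a 0.
  rewrite a00 add0r; apply: le_trans gb; rewrite big_seq [leRHS]big_seq.
  by apply: ler_sum => i iU; rewrite (zero f a a00 fa i iU) add0r.
have [b00|bn0] := eqVneq b 0.
  rewrite b00 addr0; apply: le_trans fa; rewrite big_seq [leRHS]big_seq.
  by apply: ler_sum => i iU; rewrite (zero g b b00 gb i iU) addr0.
have {an0}a0 : 0 < a by rewrite lt_def an0.
have {bn0}b0 : 0 < b by rewrite lt_def bn0.
(* AM-GM: [2 f g <= (b / a) f^2 + (a / b) g^2] *)
apply: (@le_trans _ _ (\sum_(i <- U) ((1 + b / a) * f i ^+ 2 + (1 + a / b) * g i ^+ 2))).
  apply: ler_sum => i _; rewrite -subr_ge0.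
  have -> : (1 + b / a) * f i ^+ 2 + (1 + a / b) * g i ^+ 2 - (f i + g i) ^+ 2 =
    (b * f i - a * g i) ^+ 2 / (a * b) by field; rewrite !gt_eqF.
  by rewrite divr_ge0 ?sqr_ge0// mulr_ge0 ?ltW.
rewrite big_split/= -!mulr_sumr.
have -> : (a + b) ^+ 2 = (1 + b / a) * a ^+ 2 + (1 + a / b) * b ^+ 2.
  by field; rewrite !gt_eqF.
by apply: lerD; rewrite ler_pM2l// addr_gt0// divr_gt0.
Qed.

Lemma l2_bound_sum U (J : Type) (s : seq J) (p : pred J) (F : J -> I -> R) (a : J -> R) :
  (forall j, p j -> l2_bound U (F j) (a j)) ->
  l2_bound U (fun i => \sum_(j <- s | p j) F j i) (\sum_(j <- s | p j) a j).
Proof.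
move=> Fa; elim: s => [|j s IH].
  rewrite big_nil; split => //; rewrite big1 ?sqr_ge0// => i _.
  by rewrite big_nil expr0n.
rewrite big_cons; case: ifPn => pj.
  have := l2_boundD (Fa j pj) IH; congr (l2_bound U _ _).
  by apply/funext => i; rewrite big_cons pj.
by congr (l2_bound U _ _): IH; apply/funext => i; rewrite big_cons (negbTE pj).
Qed.

Lemma l2_bound_le U f a b : a <= b -> l2_bound U f a -> l2_bound U f b.
Proof.
move=> ab [a0 fa]; split; first exact: le_trans ab.
by apply: (le_trans fa); apply: lerXn2r => //; rewrite nnegrE (le_trans a0).
Qed.

End l2_bound.

(** * Sensitivity of the weights *)

Section mad_sensitivity.
Context {Sigma : choiceType} {R : realType}.
Local Open Scope fset_scope.
Local Open Scope ring_scope.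
Variables (tau dmax bmin bmax : R) (b : Sigma -> R).
Hypotheses (tau_ge0 : 0 <= tau) (dmax_gt1 : 1 < dmax).
Hypotheses (bmin_ge : 1 / 2 <= bmin) (bmin_le1 : bmin <= 1) (bmax_ge1 : 1 <= bmax).
Implicit Types (S : dataset Sigma) (A B U : {fset Sigma}).

Let ad := @adaptive Sigma R dmax bmin.
Let bmin_gt0 : 0 < bmin. Proof. by move: bmin_ge; lra. Qed.
Let dmax_gt0 : 0 < dmax. Proof. by move: dmax_gt1; lra. Qed.
Let sdmax_gt0 : 0 < Num.sqrt dmax. Proof. by rewrite sqrtr_gt0. Qed.

Lemma l2_bound_indic U B (c : R) : B `<=` U -> 0 <= c ->
  l2_bound U (fun i => c * (i \in B)%:R) (c * Num.sqrt #|` B|%:R).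
Proof.
move=> BU c0; split; first by rewrite mulr_ge0 ?sqrtr_ge0.
rewrite exprMn sqr_sqrtr ?ler0n// mulrC -fset_sum_const -(sum_fsub _ BU) [leRHS]big_mkcond/=.
by apply: ler_sum => i _; case: ifP => _; rewrite ?mulr1// mulr0 expr0n.
Qed.

Lemma adaptive_gt0 A : ad A -> (0 < #|` A|)%N.
Proof.
move=> /andP[h _]; rewrite -ltz_nat; apply: lt_le_trans h.
by rewrite -(ltr_int R); apply: lt_le_trans (ceil_ge _); rewrite divr_gt0// exprn_gt0.
Qed.

Lemma adaptive_inv_sqrt A : ad A ->
  (Num.sqrt dmax)^-1 <= (Num.sqrt #|` A|%:R)^-1 <= bmin.
Proof.
move=> adA; have A0 := adaptive_gt0 adA; have /andP[h hd] := adA.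
have sA0 : 0 < Num.sqrt (#|` A|%:R : R) by rewrite sqrtr_gt0 ltr0n.
apply/andP; split; first by rewrite lef_pV2 ?posrE//; exact: ler_wsqrtr.
have h' : 1 / bmin ^+ 2 <= #|` A|%:R.
  by apply: le_trans (ceil_ge _) _; rewrite -(ler_int R) in h.
rewrite -[leRHS]invrK lef_pV2 ?posrE ?invr_gt0//.
rewrite -[leLHS]gtr0_norm ?invr_gt0// -sqrtr_sqr; apply: ler_wsqrtr.
by rewrite exprVn -div1r.
Qed.

Lemma alpha_ge0 : 0 <= alpha dmax bmin.
Proof.
rewrite /alpha subr_ge0; apply: le_trans bmin_ge.
rewrite div1r lef_pV2 ?posrE ?mulr_gt0// ler_pMr//.
by rewrite -[leLHS]sqrtr1; apply/ler_wsqrtr/ltW.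
Qed.

Lemma w_init_ge0 S i : 0 <= w_init S dmax bmin i.
Proof. by apply: sumr_ge0 => A _; rewrite invr_ge0. Qed.

Lemma w_init_cons A S i : w_init (A :: S) dmax bmin i =
  (if ad A && (i \in A) then (#|` A|%:R)^-1 else 0) + w_init S dmax bmin i.
Proof. by rewrite /w_init big_cons; case: ifP => // _; rewrite add0r. Qed.

Lemma excess_ratio_ge0 S i : 0 <= excess_ratio S tau dmax bmin i.
Proof. by rewrite /excess_ratio; case: ifP => // _; rewrite le_max lexx. Qed.

Lemma excess_ratio_le1 S i : excess_ratio S tau dmax bmin i <= 1.
Proof.
rewrite /excess_ratio; case: ifPn => [_|w0]; first exact: ler01.
have w_gt0 : 0 < w_init S dmax bmin i by rewrite lt_def w0 w_init_ge0.
by rewrite ge_max ler01/= ler_pdivrMr// mul1r lerBlDr lerDl.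
Qed.

Lemma excess_ratio_le A S i :
  excess_ratio S tau dmax bmin i <= excess_ratio (A :: S) tau dmax bmin i.
Proof.
rewrite {1}/excess_ratio; case: ifPn => [_|w0]; first exact: excess_ratio_ge0.
have w_gt0 : 0 < w_init S dmax bmin i by rewrite lt_def w0 w_init_ge0.
have ww' : w_init S dmax bmin i <= w_init (A :: S) dmax bmin i.
  by rewrite w_init_cons lerDr; case: ifP => // _; rewrite invr_ge0.
have w'_gt0 := lt_le_trans w_gt0 ww'.
rewrite /excess_ratio gt_eqF// ge_max !le_max lexx/=; apply/orP; right.
rewrite !mulrBl !divff ?gt_eqF// lerD2l lerN2 ler_wpM2l//.
by rewrite lef_pV2.
Qed.

Lemma excess_ratioM S i : excess_ratio S tau dmax bmin i * w_init S dmax bmin i =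
  w_init S dmax bmin i - w_trunc S tau dmax bmin i.
Proof.
rewrite /excess_ratio /w_trunc; case: ifPn => [/eqP ->|w0].
  by rewrite mul0r (min_idPl tau_ge0) subrr.
have w_gt0 : 0 < w_init S dmax bmin i by rewrite lt_def w0 w_init_ge0.
have [wt|/ltW wt] := leP tau (w_init S dmax bmin i).
  by rewrite max_r ?divfK// divr_ge0 ?subr_ge0// ltW.
rewrite max_l ?mul0r ?subrr// pmulr_lle0 ?invr_gt0// subr_le0//.
Qed.

(** Thanks to this monotonicity the increments in [rerouted] are nonnegative, and their sizes add up
    without cancellation. *)
Lemma excess_le A S B : excess S tau dmax bmin B <= excess (A :: S) tau dmax bmin B.
Proof.
rewrite /excess ler_wpM2l ?invr_ge0//; apply: ler_sum => i _.
exact: excess_ratio_le.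
Qed.

Lemma excess_ge0 S B : 0 <= excess S tau dmax bmin B.
Proof.
by rewrite /excess mulr_ge0 ?invr_ge0// sumr_ge0// => i _; exact: excess_ratio_ge0.
Qed.

(* Each adaptive user spreads one unit of initial weight over his items, so the
   excess fractions add up to the total weight above the threshold. *)
Lemma sum_excess S U : {in S, forall B, B `<=` U} ->
  \sum_(B <- S | ad B) excess S tau dmax bmin B =
  \sum_(i <- U) (w_init S dmax bmin i - w_trunc S tau dmax bmin i).
Proof.
move=> SU.
transitivity (\sum_(i <- U) \sum_(B <- S | ad B && (i \in B))
    excess_ratio S tau dmax bmin i * (#|` B|%:R)^-1); last first.
  by apply: eq_bigr => i _; rewrite -mulr_sumr -excess_ratioM.
under [RHS]eq_bigr do rewrite big_mkcondr/=.
rewrite exchange_big/= big_seq_cond [RHS]big_seq_cond; apply: eq_bigr => B /andP[BS _].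
rewrite /excess -(sum_fsub _ (SU B BS)) -big_mkcond/= mulr_sumr.
by apply: eq_bigr => i _; rewrite mulrC.
Qed.

Definition kappa (d : R) := bmin / Num.sqrt d - (2 * d)^-1.

Lemma alpha_kappa A : ad A -> alpha dmax bmin / Num.sqrt dmax <= kappa #|` A|%:R.
Proof.
move=> adA; have /andP[] := adaptive_inv_sqrt adA.
have A0 : 0 < (#|` A|%:R : R) by rewrite ltr0n adaptive_gt0.
have t2 : ((Num.sqrt #|` A|%:R)^-1) ^+ 2 = (#|` A|%:R)^-1 :> R.
  by rewrite exprVn sqr_sqrtr// ltW.
rewrite /kappa /alpha !invfM -t2.
set t := (Num.sqrt #|` A|%:R)^-1; set y := (Num.sqrt dmax)^-1 => yt tb.
(* The difference is [(t - y) * (bmin - (t + y) / 2)], and [y <= t <= bmin]. *)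
by nra.
Qed.

Local Notation uw A := (user_weights A b bmin bmax).

Lemma mad_cons_nonadaptive A S i : ~~ ad A ->
  mad (A :: S) tau dmax b bmin bmax i =
  mad S tau dmax b bmin bmax i + (if i \in A then uw A i else 0).
Proof.
move=> nadA.
have wE : w_init (A :: S) dmax bmin = w_init S dmax bmin.
  by apply/funext => j; rewrite w_init_cons (negbTE nadA) add0r.
have rE : excess_ratio (A :: S) tau dmax bmin = excess_ratio S tau dmax bmin.
  by apply/funext => j; rewrite /excess_ratio wE.
have eE : excess (A :: S) tau dmax bmin = excess S tau dmax bmin.
  by apply/funext => B; rewrite /excess rE.
rewrite /mad /w_trunc wE /w_reroute !big_cons eE -/(ad A) (negbTE nadA)/=.
by case: ifP => _; rewrite ?addr0// [in LHS]addrCA [RHS]addrC.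
Qed.

(** The first term is sent out by [A], the sum by the other users, whose excess grows when [A]
    joins. *)
Definition rerouted A S i := alpha dmax bmin / dmax * excess (A :: S) tau dmax bmin A * (i \in A)%:R
  + \sum_(B <- S | ad B) alpha dmax bmin / dmax *
     (excess (A :: S) tau dmax bmin B - excess S tau dmax bmin B) * (i \in B)%:R.

(** The growth of the amount cut off at [i] when [A] joins; its total is the X of the overview. *)
Definition shaved A S i := (w_init (A :: S) dmax bmin i - w_trunc (A :: S) tau dmax bmin i) -
  (w_init S dmax bmin i - w_trunc S tau dmax bmin i).

(** The initial weight [1 / d] enters through [w_init] and is subtracted again in the last step, so
    without truncation [A] would contribute exactly its user weight. *)
Lemma mad_cons_adaptive A S i : ad A ->
  mad (A :: S) tau dmax b bmin bmax i - mad S tau dmax b bmin bmax i =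
  ((if i \in A then uw A i else 0) - shaved A S i) + rerouted A S i.
Proof.
move=> adA; rewrite /rerouted /shaved w_init_cons adA/=.
rewrite /mad [w_reroute (A :: S) _ _ _ i]/w_reroute !big_cons -/(ad A) adA/=.
have -> : \sum_(B <- S | ad B) alpha dmax bmin / dmax *
     (excess (A :: S) tau dmax bmin B - excess S tau dmax bmin B) * (i \in B)%:R =
  \sum_(B <- S | ad B && (i \in B)) alpha dmax bmin * excess (A :: S) tau dmax bmin B / dmax
  - w_reroute S tau dmax bmin i.
  rewrite /w_reroute -sumrB [RHS]big_mkcondr/=; apply: eq_bigr => B _.
  case: ifP => _; last by rewrite mulr0.
  by rewrite mulr1 mulrBr mulrAC [in X in _ - X]mulrAC.
case: ifP => _.
  have -> : alpha dmax bmin * excess (A :: S) tau dmax bmin A / dmax =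
    alpha dmax bmin / dmax * excess (A :: S) tau dmax bmin A by rewrite mulrAC.
  by rewrite mulr1; ring.
by rewrite mulr0; ring.
Qed.

(** The amount cut off, [x - min x tau], is nondecreasing and 1-Lipschitz in [x]. *)
Lemma shaved_bounds A S i : ad A ->
  0 <= shaved A S i <= (if i \in A then (#|` A|%:R)^-1 else 0).
Proof.
move=> adA; rewrite /shaved /w_trunc w_init_cons adA/=.
set w := w_init S dmax bmin i.
have d0 : 0 <= (#|` A|%:R)^-1 :> R by rewrite invr_ge0.
case: ifP => _; last by rewrite !add0r subrr lexx.
have [h1|h1] := leP (#|` A|%:R^-1 + w) tau; have [h2|h2] := leP w tau; lra.
Qed.

Lemma sum_shaved A S U : ad A -> {in A :: S, forall B, B `<=` U} ->
  \sum_(i <- U) shaved A S i =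
  excess (A :: S) tau dmax bmin A +
  \sum_(B <- S | ad B) (excess (A :: S) tau dmax bmin B - excess S tau dmax bmin B).
Proof.
move=> adA SU; rewrite sumrB -(sum_excess SU) big_cons adA -sum_excess ?sumrB ?addrA//.
by move=> B BS; apply: SU; rewrite inE BS orbT.
Qed.

(** A user with excess [c] puts [alpha * c / dmax] on at most [dmax] items, a vector of norm at most
    [alpha * c / sqrt dmax]. The increments of excess add up to the total shaved off. *)
Lemma rerouted_l2 A S U : ad A -> {in A :: S, forall B, B `<=` U} ->
  l2_bound U (rerouted A S)
    (alpha dmax bmin / Num.sqrt dmax * \sum_(i <- U) shaved A S i).
Proof.
move=> adA SU; rewrite (sum_shaved adA SU) mulrDr mulr_sumr.
have k0 : 0 <= alpha dmax bmin / dmax by rewrite divr_ge0 ?alpha_ge0 ?ltW.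
have bnd B c : ad B -> B `<=` U -> 0 <= c ->
    l2_bound U (fun i => alpha dmax bmin / dmax * c * (i \in B)%:R)
      (alpha dmax bmin / Num.sqrt dmax * c).
  move=> adB BU c0; apply: l2_bound_le (l2_bound_indic BU (mulr_ge0 k0 c0)).
  rewrite mulrAC ler_wpM2r// -!mulrA ler_wpM2l ?alpha_ge0//.
  rewrite -[X in X^-1 * _](sqr_sqrtr (ltW dmax_gt0)) ler_pdivrMl ?exprn_gt0//.
  rewrite expr2 mulfK ?gt_eqF//; apply: ler_wsqrtr.
  by have /andP[] := adB.
apply: l2_boundD.
  by apply: bnd => //; [apply: SU; rewrite mem_head|exact: excess_ge0].
rewrite big_seq_cond [X in l2_bound _ X _](_ : _ = fun i => \sum_(B <- S | (B \in S) && ad B)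
  alpha dmax bmin / dmax *
     (excess (A :: S) tau dmax bmin B - excess S tau dmax bmin B) * (i \in B)%:R); last first.
  by apply/funext => i; rewrite big_seq_cond.
apply: l2_bound_sum => B /andP[BS adB]; apply: bnd => //.
  by apply: SU; rewrite inE BS orbT.
by rewrite subr_ge0 excess_le.
Qed.

(** Shaving [x] off a weight [w] lowers its square by [x * (2 * w - x)], where [w >= bmin / sqrt d]
    and [x <= 1 / d] give [2 * w - x >= 2 * kappa]. The sum [1 - 2 * kappa * X] is then at most the
    square of [1 - kappa * X]. *)
Lemma kept_l2 A S U : ad A -> A `<=` U ->
  l2_bound U (fun i => (if i \in A then uw A i else 0) - shaved A S i)
    (1 - kappa #|` A|%:R * \sum_(i <- U) shaved A S i).
Proof.
move=> adA AU; have A0 := adaptive_gt0 adA.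
have d0 : 0 < (#|` A|%:R : R) by rewrite ltr0n.
have [uwb uwn] := user_weights_ok b bmin_gt0 bmin_le1 bmax_ge1 A0.
have sh0 i : i \notin A -> shaved A S i = 0.
  by move=> iA; have := shaved_bounds S i adA; rewrite (negbTE iA) -eq_le => /eqP.
have shX : \sum_(i <- U) shaved A S i = \sum_(i <- A) shaved A S i.
  rewrite -(sum_fsub _ AU) [RHS]big_mkcond/=; apply: eq_bigr => i _.
  by case: ifPn => // /sh0.
set X := \sum_(i <- U) shaved A S i.
have t2 : ((Num.sqrt #|` A|%:R)^-1) ^+ 2 = (#|` A|%:R)^-1 :> R.
  by rewrite exprVn sqr_sqrtr// ltW.
have t0 : 0 < (Num.sqrt #|` A|%:R)^-1 :> R by rewrite invr_gt0 sqrtr_gt0.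
have /andP[_ tb] := adaptive_inv_sqrt adA.
have X0 : 0 <= X.
  by rewrite /X shX sumr_ge0// => i _; have /andP[] := shaved_bounds S i adA.
have X1 : X <= 1.
  rewrite /X shX -(divff (lt0r_neq0 d0)) -fset_sum_const big_seq [leRHS]big_seq.
  by apply: ler_sum => i iA; have := shaved_bounds S i adA; rewrite iA => /andP[].
have k0 : 0 <= kappa #|` A|%:R by rewrite /kappa invfM -t2; nra.
have k1 : kappa #|` A|%:R <= 1.
  have bt : bmin * (Num.sqrt #|` A|%:R)^-1 <= 1.
    by apply: mulr_ile1; rewrite ?(ltW bmin_gt0) ?(ltW t0) ?(le_trans tb).
  by rewrite /kappa invfM -t2; nra.
split; first by nra.
apply: (@le_trans _ _ (1 - 2 * kappa #|` A|%:R * X)); last by nra.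
have -> : \sum_(i <- U) ((if i \in A then uw A i else 0) - shaved A S i) ^+ 2 =
    \sum_(i <- A) (uw A i - shaved A S i) ^+ 2.
  rewrite -(sum_fsub _ AU) [RHS]big_mkcond/=; apply: eq_bigr => i _.
  by case: ifPn => // /sh0 ->; rewrite subr0 expr0n.
apply: (@le_trans _ _ (\sum_(i <- A) (uw A i ^+ 2 - 2 * kappa #|` A|%:R * shaved A S i))).
  rewrite big_seq [leRHS]big_seq; apply: ler_sum => i iA.
  have := shaved_bounds S i adA; rewrite iA => /andP[x0 x1].
  have /andP[ul _] := uwb i iA.
  have {}ul : 2 * kappa #|` A|%:R <= 2 * uw A i - shaved A S i.
    by move: ul x1; rewrite /kappa invfM; lra.
  by nra.
by rewrite sumrB -mulr_sumr -shX -/X lerB.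
Qed.

Lemma mad_sensitivity A S U : {in A :: S, forall B, B `<=` U} ->
  \sum_(i <- U) (mad (A :: S) tau dmax b bmin bmax i - mad S tau dmax b bmin bmax i) ^+ 2 <= 1.
Proof.
move=> SU; have AU : A `<=` U by apply: SU; rewrite mem_head.
have [adA|nadA] := boolP (ad A).
  under eq_bigr do rewrite mad_cons_adaptive//.
  have [_] := l2_boundD (kept_l2 S adA AU) (rerouted_l2 adA SU).
  move/le_trans; apply; rewrite -[leRHS](expr1n _ 2).
  have k := alpha_kappa adA.
  have X0 : 0 <= \sum_(i <- U) shaved A S i.
    by apply: sumr_ge0 => i _; have /andP[] := shaved_bounds S i adA.
  apply: lerXn2r; rewrite ?nnegrE ?ler01//.
    apply: addr_ge0; first by case: (kept_l2 S adA AU).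
    by case: (rerouted_l2 adA SU).
  by rewrite -lerBrDl opprB addrC subrK ler_wpM2r.
under eq_bigr do rewrite mad_cons_nonadaptive// addrC addKr.
have [A0|A0] := posnP #|` A|.
  rewrite big1// => i _; case: ifPn => iA; rewrite ?expr0n//.
  by move: A0 => /eqP; rewrite cardfs_eq0 => /eqP A0; rewrite A0 inE in iA.
have [uwb uwn] := user_weights_ok b bmin_gt0 bmin_le1 bmax_ge1 A0.
apply: le_trans uwn; rewrite /sq_norm -(sum_fsub _ AU) [leRHS]big_mkcond/=.
by apply: ler_sum => i _; case: ifP => _; rewrite ?expr0n.
Qed.

End mad_sensitivity.

(** * Weights of items that only one user holds *)

Section mad_novel.
Context {Sigma : choiceType} {R : realType}.
Local Open Scope fset_scope.
Local Open Scope ring_scope.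
Variables (tau dmax bmin bmax : R).
Implicit Types (S : dataset Sigma) (A B U : {fset Sigma}) (b : Sigma -> R).

Lemma mem_universe S i : (i \in universe S) = has (fun B : {fset Sigma} => i \in B) S.
Proof.
rewrite /universe; elim: S => [|B S IH]; first by rewrite big_nil inE.
by rewrite big_cons in_fsetU IH.
Qed.

Lemma sub_universe S B : B \in S -> B `<=` universe S.
Proof. by move=> BS; apply/fsubsetP => i iB; rewrite mem_universe; apply/hasP; exists B. Qed.

Lemma mad_perm S S' b : perm_eq S S' ->
  mad S tau dmax b bmin bmax = mad S' tau dmax b bmin bmax.
Proof.
move=> SS'.
have wE : w_init S dmax bmin = w_init S' dmax bmin.
  by apply/funext => j; exact: perm_big.
have rE : excess_ratio S tau dmax bmin = excess_ratio S' tau dmax bmin.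
  by apply/funext => j; rewrite /excess_ratio wE.
have eE : excess S tau dmax bmin = excess S' tau dmax bmin.
  by apply/funext => B; rewrite /excess rE.
apply/funext => i; rewrite /mad /w_trunc /w_reroute wE eE.
by congr (_ + _ + _ + _); exact: perm_big.
Qed.

Lemma mad_ext S b b' : (forall B, B \in S -> {in B, b =1 b'}) ->
  mad S tau dmax b bmin bmax = mad S tau dmax b' bmin bmax.
Proof.
move=> bb'; apply/funext => i.
have sE (p : pred {fset Sigma}) (c : {fset Sigma} -> R) :
    \sum_(B <- S | p B) (user_weights B b bmin bmax i - c B) =
    \sum_(B <- S | p B) (user_weights B b' bmin bmax i - c B).
  rewrite big_seq_cond [RHS]big_seq_cond; apply: eq_bigr => B /andP[BS _].
  by rewrite (user_weights_ext _ _ (bb' B BS)).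
rewrite /mad sE; have := sE (fun B => ~~ adaptive dmax bmin B && (i \in B)) (fun=> 0).
by under eq_bigr do rewrite subr0; under [RHS]eq_bigr do rewrite subr0; move=> ->.
Qed.

Lemma sum_notin_universe S i (p : pred {fset Sigma}) (F : {fset Sigma} -> R) :
  i \notin universe S -> \sum_(B <- S | p B && (i \in B)) F B = 0.
Proof.
move=> iS; rewrite big_seq_cond big1// => B /andP[BS /andP[_ iB]].
by move: iS; rewrite (fsubsetP (sub_universe BS) i iB).
Qed.

Hypotheses (tau_ge1 : 1 <= tau) (dmax_gt1 : 1 < dmax).
Hypotheses (bmin_ge : 1 / 2 <= bmin) (bmin_le1 : bmin <= 1) (bmax_ge1 : 1 <= bmax).

Lemma mad_notin S b i : i \notin universe S -> mad S tau dmax b bmin bmax i = 0.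
Proof.
move=> iS; have tau0 : 0 <= tau := le_trans ler01 tau_ge1.
by rewrite /mad /w_trunc /w_init /w_reroute !sum_notin_universe// (min_idPl tau0) !addr0.
Qed.

Definition novel_items A S := [fset i in A | i \notin universe S].

(* The rerouted weight received by an item that only user A holds comes from
   overfull items of A, which other users hold: with t novel items it is at most
   a fraction 1 - t / |A| of alpha / dmax, and this is paid for by the gap between
   bmax / sqrt |A| and bmax / sqrt t. *)
Lemma mad_novel A S b i : i \in A -> i \notin universe S ->
  mad (A :: S) tau dmax b bmin bmax i <= bmax / Num.sqrt #|` novel_items A S|%:R.
Proof.
move=> iA iS; have tau0 : 0 <= tau := le_trans ler01 tau_ge1.
have bmin0 : 0 < bmin by move: bmin_ge; lra.
have dmax0 : 0 < dmax by move: dmax_gt1; lra.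
have A0 : (0 < #|` A|)%N by rewrite cardfs_gt0; apply/fset0Pn; exists i.
pose V := novel_items A S.
have VA : V `<=` A by apply/fsubsetP => j; rewrite !inE => /andP[].
have V0 : (0 < #|` V|)%N.
  by rewrite cardfs_gt0; apply/fset0Pn; exists i; rewrite !inE iA.
have Vle : (#|` V| <= #|` A|)%N by exact: fsubset_leq_card.
set d : R := #|` A|%:R; set t : R := #|` V|%:R.
have d0 : 0 < d by rewrite ltr0n.
have t0 : 0 < t by rewrite ltr0n.
pose x := (Num.sqrt t)^-1; pose y := (Num.sqrt d)^-1.
have x0 : 0 < x by rewrite invr_gt0 sqrtr_gt0.
have y0 : 0 < y by rewrite invr_gt0 sqrtr_gt0.
have x2 : t * x ^+ 2 = 1 by rewrite exprVn sqr_sqrtr ?divff ?gt_eqF// ltW.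
have y2 : y ^+ 2 = d^-1 by rewrite exprVn sqr_sqrtr// ltW.
have yx : y <= x.
  by rewrite lef_pV2 ?posrE ?sqrtr_gt0//; apply: ler_wsqrtr; rewrite ler_nat.
have [uwb _] := user_weights_ok b bmin0 bmin_le1 bmax_ge1 A0.
have /andP[_ uwi] := uwb i iA.
have uwx : user_weights A b bmin bmax i <= bmax * x.
  by apply: le_trans uwi _; rewrite ler_wpM2l// (le_trans ler01).
rewrite -[leLHS]subr0 -(mad_notin b iS).
have [adA|nadA] := boolP (adaptive dmax bmin A); last first.
  by rewrite mad_cons_nonadaptive// iA addrC addKr.
rewrite mad_cons_adaptive// /rerouted iA.
have /andP[sh0 _] := shaved_bounds tau S i adA.
rewrite [X in _ + (_ + X)]big1_seq ?addr0 ?mulr1; last first.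
  move=> B /andP[_ BS]; case: (boolP (i \in B)) => [iB|]; last by rewrite mulr0.
  by move: iS; rewrite (fsubsetP (sub_universe BS) i iB).
set e := excess _ _ _ _ _; set k := alpha dmax bmin / dmax.
have e0 : 0 <= e by exact: excess_ge0.
(* Novel items have excess ratio 0, since their initial weight [1 / d] is at most [1 <= tau]; the
   other ratios are at most 1. *)
have ed : e <= 1 - t * y ^+ 2.
  rewrite /e /excess y2 -/d ler_pdivrMl// mulrBr mulr1 mulrCA divff ?gt_eqF// mulr1.
  have -> : d - t = #|` A `\` V|%:R.
    rewrite /d -(cardfsID V A) natrD (fsetIidPr VA) addrC addKr //.
  rewrite -[leRHS]mulr1 -fset_sum_const -[leRHS](sum_fsub _ (fsubsetDl A V)).
  rewrite big_mkcond [leRHS]big_mkcond/= big_seq [leRHS]big_seq.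
  apply: ler_sum => j jA; rewrite in_fsetD jA andbT.
  case: ifPn => jV; first exact: (excess_ratio_le1 _ _ tau0).
  move: jV; rewrite negbK !inE jA/= => jS.
  rewrite /excess_ratio; case: ifP => // _.
  rewrite w_init_cons adA jA/= /w_init sum_notin_universe// addr0 invrK.
  rewrite ge_max lexx/= pmulr_lle0// subr_le0 (le_trans _ tau_ge1)//.
  by rewrite invf_le1// ler1n.
have k0 : 0 <= k by rewrite divr_ge0 ?alpha_ge0// ltW.
(* With [s = 1 / sqrt dmax] and [bmin <= 1], this reduces to [s * (1 - s) ^+ 2 >= 0]. *)
have ky : 2 * k <= y.
  have /andP[sy _] := adaptive_inv_sqrt dmax_gt1 bmin_ge adA.
  apply: le_trans sy; rewrite /k /alpha.
  have s0 : 0 < (Num.sqrt dmax)^-1 by rewrite invr_gt0 sqrtr_gt0.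
  have -> : dmax^-1 = (Num.sqrt dmax)^-1 ^+ 2 by rewrite exprVn sqr_sqrtr// ltW.
  rewrite invfM; set s := (Num.sqrt dmax)^-1 in s0 *.
  apply: (@le_trans _ _ (2 * ((1 - 2^-1 * s) * s ^+ 2))).
    by rewrite ler_pM2l// ler_wpM2r ?sqr_ge0// lerD2r.
  rewrite -subr_ge0; have -> : s - 2 * ((1 - 2^-1 * s) * s ^+ 2) = s * (1 - s) ^+ 2 by field.
  by rewrite mulr_ge0 ?sqr_ge0// ltW.
(* [q] is the root of the fraction of novel items in [A], so that [e <= 1 - q ^+ 2]. *)
pose q := y / x.
have q0 : 0 <= q by rewrite divr_ge0// ltW.
have q1 : q <= 1 by rewrite ler_pdivrMr// mul1r.
have yq : y = q * x by rewrite /q divfK// gt_eqF.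
have tq : t * y ^+ 2 = q ^+ 2 by rewrite yq exprMn mulrCA x2 mulr1.
have uwy : user_weights A b bmin bmax i <= bmax * (q * x) by rewrite -yq.
apply: (@le_trans _ _ (bmax * (q * x) + k * (1 - q ^+ 2))).
  apply: lerD; first by rewrite (le_trans _ uwy)// gerBl.
  by rewrite ler_wpM2l// -tq.
(* A factor [1 - q] comes out of the remaining inequality, which leaves this one. *)
have kx : k * (1 + q) <= bmax * x.
  apply: (@le_trans _ _ x); last by rewrite ler_peMl// ltW.
  by apply: le_trans yx; apply: le_trans ky; nra.
rewrite -/x -subr_ge0.
have -> : bmax * x - (bmax * (q * x) + k * (1 - q ^+ 2)) = (1 - q) * (bmax * x - k * (1 + q)).
  by ring.
by rewrite mulr_ge0// subr_ge0.
Qed.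

End mad_novel.

(** * The two rounds *)

Section rounds.
Context {Sigma : choiceType} {R : realType}.
Local Open Scope fset_scope.
Local Open Scope ring_scope.
Local Notation X := (measurableTypeR R).
Local Notation N s := (normal_prob (0 : R) s).
Implicit Types (S T : dataset Sigma) (A B U V : {fset Sigma}) (b W x : Sigma -> R).

Lemma mem_novel A S i : (i \in novel_items A S) = (i \in A) && (i \notin universe S).
Proof. by rewrite !inE. Qed.

Lemma universe_cons A S : universe (A :: S) = A `|` universe S.
Proof. by rewrite /universe big_cons. Qed.

Lemma depends_onS (V : Type) (U U' : pred Sigma) (F : (Sigma -> R) -> V) :
  {subset U <= U'} -> depends_on U F -> depends_on U' F.
Proof. by move=> UU' dF x y xy; apply: dF => i /UU' /xy. Qed.

(** Serves both rounds. In round 1 the continuations are the round 2 probabilities; in round 2 they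
    are indicators of the event, with [eps' = delta' = 0]. *)
Lemma mad_round (s eps delta eps' delta' : R) Delta0 tau dmax b bmin bmax A S
    (f g : (Sigma -> R) -> \bar R) (U := universe (A :: S))
    (rho := threshold bmax s delta Delta0) :
  gaussian_noise_level eps (delta / 2) s -> 0 < delta < 1 ->
  1 <= tau -> 1 < dmax -> 1 / 2 <= bmin -> bmin <= 1 -> 1 <= bmax ->
  (#|` A| <= Delta0)%N ->
  (forall y, 0 <= f y <= 1)%E -> (forall y, 0 <= g y <= 1)%E ->
  depends_on (mem U) f -> depends_on (mem U) g -> 0 <= delta' ->
  (forall y, (forall i, i \in novel_items A S -> y i < rho) ->
     (f y <= (expR eps')%:E * g y + delta'%:E)%E /\
     (g y <= (expR eps')%:E * f y + delta'%:E)%E) ->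
  let I1 := noise_integral (N s) (0 : X) U
    (fun x => f (fun i => mad (A :: S) tau dmax b bmin bmax i + x i)) in
  let I0 := noise_integral (N s) (0 : X) U
    (fun x => g (fun i => mad S tau dmax b bmin bmax i + x i)) in
  (I1 <= (expR (eps + eps'))%:E * I0 + (delta + delta')%:E)%E /\
  (I0 <= (expR (eps + eps'))%:E * I1 + (delta + delta')%:E)%E.
Proof.
move=> nl d01 tau1 dmax1 bmin_ge bmin1 bmax1 AD f01 g01 df dg d'0 fg I1 I0.
have tau0 : 0 <= tau := le_trans ler01 tau1.
have s0 : 0 < s := nl.1.
have VU : {subset (novel_items A S : seq Sigma) <= (U : seq Sigma)}.
  by move=> i; rewrite /U universe_cons !inE => /andP[-> _].
have VD : (size (novel_items A S) <= Delta0)%N.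
  apply: leq_trans AD; apply: fsubset_leq_card.
  by apply/fsubsetP => i; rewrite !inE => /andP[].
have SU : {in A :: S, forall B, B `<=` U} by move=> B; exact: sub_universe.
have sens := mad_sensitivity b tau0 dmax1 bmin_ge bmin1 bmax1 SU.
have deltaE : delta / 2 + delta' + delta / 2 = delta + delta' by field.
split.
- rewrite -deltaE; apply: (gaussian_transfer (V := novel_items A S) (rho := rho)) => //.
  + by move=> y; have /andP[] := g01 y.
  + by move=> y /fg[].
  + apply: prob_novel_item_above => // i; rewrite !inE => /andP[iA iS].
    exact: mad_novel.
- rewrite -deltaE; apply: (gaussian_transfer (V := novel_items A S) (rho := rho)) => //.
  + by under eq_bigr do rewrite -sqrrN opprB.
  + by move=> y; have /andP[] := f01 y.
  + by move=> y /fg[].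
  + apply: prob_novel_item_above => // i; rewrite !inE => /andP[iA iS].
    (* In the run without [A] the novel items have weight 0, so the same threshold works. *)
    by rewrite mad_notin// divr_ge0 ?sqrtr_ge0// (le_trans ler01).
Qed.

Section fixed_parameters.
Variables (rho1 rho2 tau2 dmax Clb Cub bmin bmax sigma1 sigma2 : R).

(** Round 2 sees round 1 only through the noisy weights [W]; everything from here on is a function
    of them. *)
Definition above1 S W := [fset i in universe S | rho1 <= W i].
Definition below2 S W := [fset i in universe S | W i + Cub * sigma1 < rho2].
Definition dataset2 S W : dataset Sigma := [seq A `\` (above1 S W `|` below2 S W) | A <- S].
Definition bias W i :=
  if Num.max 0 (W i - Clb * sigma1) == 0 then 1
  else Num.min 1 (rho2 / Num.max 0 (W i - Clb * sigma1)).
Definition mad2 S W := mad (dataset2 S W) tau2 dmax (bias W) bmin bmax.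
Definition output2 S W x : {fset Sigma} :=
  above1 S W `|` [fset i in universe (dataset2 S W) | rho2 <= mad2 S W i + x i].

Variable O : set {fset Sigma}.

Definition event (B : {fset Sigma}) : \bar R := (`[< O B >])%:R%:E.

Lemma event01 B : (0 <= event B <= 1)%E.
Proof. by rewrite /event !lee_fin ler0n/=; case: `[< _ >]. Qed.

Definition prob2 S W : \bar R :=
  noise_integral (N sigma2) (0 : X) (universe S) (fun x => event (output2 S W x)).

Lemma universe2_sub S W : universe (dataset2 S W) `<=` universe S.
Proof.
apply/fsubsetP => i; rewrite !mem_universe has_map => /hasP[B BS /=].
by rewrite in_fsetD => /andP[_ iB]; apply/hasP; exists B.
Qed.

Lemma prob2_depends S : depends_on (mem (universe S)) (prob2 S).
Proof.
move=> W W' WW'.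
have aE : above1 S W = above1 S W'.
  by apply/fsetP => i; rewrite !inE/=; case: (boolP (i \in universe S)) => //= /WW' ->.
have bE : below2 S W = below2 S W'.
  by apply/fsetP => i; rewrite !inE/=; case: (boolP (i \in universe S)) => //= /WW' ->.
have dE : dataset2 S W = dataset2 S W' by rewrite /dataset2 aE bE.
have mE : mad2 S W = mad2 S W'.
  rewrite /mad2 dE; apply: mad_ext => B BS i iB; rewrite /bias WW'//.
  exact: (fsubsetP (universe2_sub S W') i (fsubsetP (sub_universe BS) i iB)).
have oE : output2 S W = output2 S W' by apply/funext => x; rewrite /output2 mE aE dE.
by rewrite /prob2 oE.
Qed.

Lemma prob2_01 S W : (0 <= prob2 S W <= 1)%E.
Proof.
apply/andP; split.
  by apply: integral_ge0 => z _; have /andP[] := event01 (output2 S W (noise (0 : X) (universe S) z)).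
rewrite -[leRHS](integral_prob_cst (iid (N sigma2) (size (universe S)))).
by apply: ge0_le_lower_integral => z; have /andP[] := event01 (output2 S W (noise (0 : X) (universe S) z)).
Qed.

(** Novel items may enter [below2 (A :: S) W], but no other user holds them, so the remaining sets
    of the others are the same in both runs. *)
Lemma dataset2_cons A S W : (forall i, i \in novel_items A S -> W i < rho1) ->
  above1 (A :: S) W = above1 S W /\
  dataset2 (A :: S) W = A `\` (above1 S W `|` below2 (A :: S) W) :: dataset2 S W.
Proof.
move=> good.
have aE : above1 (A :: S) W = above1 S W.
  apply/fsetP => i; rewrite !inE/= universe_cons in_fsetU.
  case: (boolP (i \in universe S)) => iS; first by rewrite orbT.
  rewrite orbF; apply/negbTE/negP => /andP[iA].
  by rewrite leNgt good// !inE iA.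
split => //; rewrite /dataset2 /= aE; congr (_ :: _).
apply/eq_in_map => B BS; apply/fsetP => i; rewrite !in_fsetD !in_fsetU.
case: (boolP (i \in B)) => iB; rewrite ?andbF// !andbT.
have iS := fsubsetP (sub_universe BS) i iB.
by rewrite !inE/= universe_cons in_fsetU iS orbT.
Qed.

Hypotheses (tau2_ge1 : 1 <= tau2) (dmax_gt1 : 1 < dmax).
Hypotheses (bmin_ge : 1 / 2 <= bmin) (bmin_le1 : bmin <= 1) (bmax_ge1 : 1 <= bmax).

Lemma prob2_dp (eps2 delta2 : R) Delta0 A S W :
  gaussian_noise_level eps2 (delta2 / 2) sigma2 -> 0 < delta2 < 1 ->
  rho2 = threshold bmax sigma2 delta2 Delta0 -> (#|` A| <= Delta0)%N ->
  (forall i, i \in novel_items A S -> W i < rho1) ->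
  (prob2 (A :: S) W <= (expR eps2)%:E * prob2 S W + delta2%:E)%E /\
  (prob2 S W <= (expR eps2)%:E * prob2 (A :: S) W + delta2%:E)%E.
Proof.
move=> nl d01 rho2E AD good.
have [aE dE] := dataset2_cons good.
pose A2 := A `\` (above1 S W `|` below2 (A :: S) W).
pose S2 := dataset2 S W.
pose F T y := event (above1 S W `|` [fset i in universe T | rho2 <= y i]).
have dF T (y y' : Sigma -> R) : {in universe T, y =1 y'} -> F T y = F T y'.
  move=> yy'; rewrite /F; congr (event (_ `|` _)); apply/fsetP => i; rewrite !inE/=.
  by case: (boolP (i \in universe T)) => //= /yy' ->.
have F01 T y : (0 <= F T y <= 1)%E by exact: event01.
have U2 : universe (A2 :: S2) `<=` universe (A :: S).
  by rewrite /A2 /S2 -dE; exact: universe2_sub.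
have S2U : universe S2 `<=` universe (A2 :: S2) by rewrite universe_cons fsubsetUr.
(* Noise is drawn on the full universe, whereas the output depends only on the items that remain. *)
have restrict T U m : universe T `<=` U ->
    noise_integral (N sigma2) (0 : X) U (fun x => F T (fun i => m i + x i)) =
    noise_integral (N sigma2) (0 : X) (universe T) (fun x => F T (fun i => m i + x i)).
  move=> /fsubsetP TU; apply: noise_integral_sub => //; rewrite ?fset_uniq//.
  - by move=> x; have /andP[] := F01 T (fun i => m i + x i).
  - by move=> x y xy; apply: dF => i /xy ->.
have -> : prob2 (A :: S) W = noise_integral (N sigma2) (0 : X) (universe (A2 :: S2))
    (fun x => F (A2 :: S2) (fun i => mad (A2 :: S2) tau2 dmax (bias W) bmin bmax i + x i)).
  by rewrite -(restrict _ _ _ U2) /prob2 /output2 /mad2 dE aE.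
have -> : prob2 S W = noise_integral (N sigma2) (0 : X) (universe (A2 :: S2))
    (fun x => F S2 (fun i => mad S2 tau2 dmax (bias W) bmin bmax i + x i)).
  by rewrite (restrict _ _ _ S2U) -(restrict _ _ _ (universe2_sub S W)).
have A2D : (#|` A2| <= Delta0)%N.
  by apply: leq_trans AD; apply: fsubset_leq_card; exact: fsubsetDl.
have := @mad_round sigma2 eps2 delta2 0 0 Delta0 tau2 dmax (bias W) bmin bmax A2 S2
   (F (A2 :: S2)) (F S2) nl d01 tau2_ge1 dmax_gt1 bmin_ge bmin_le1 bmax_ge1 A2D (F01 _) (F01 _).
rewrite !addr0 /=; apply => //.
- by move=> y y' yy'; apply: dF.
- by move=> y y' yy'; apply: dF => i /(fsubsetP S2U); exact: yy'.
- move=> y; rewrite -rho2E => ylt.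
  (* Novel items below the threshold are not output, so both runs yield the same set. *)
  have -> : F (A2 :: S2) y = F S2 y.
    rewrite /F; congr (event (_ `|` _)); apply/fsetP => i; rewrite !inE/= universe_cons in_fsetU.
    case: (boolP (i \in universe S2)) => iS; first by rewrite orbT.
    rewrite orbF; apply/negbTE/negP => /andP[iA].
    by rewrite leNgt ylt// mem_novel iA.
  by rewrite expR0 mul1e adde0.
Qed.

End fixed_parameters.
End rounds.

(** * Averaging over the subsampling *)

Section average.
Context {Sigma : choiceType} {R : realType}.
Local Open Scope fset_scope.
Local Open Scope ring_scope.
Implicit Types (S T : dataset Sigma) (A B : {fset Sigma}).

Definition mean (J : Type) (s : seq J) (F : J -> R) : R :=
  (size s)%:R^-1 * \sum_(j <- s) F j.

Lemma bounded_subsets_card Delta0 A B : B \in bounded_subsets Delta0 A ->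
  (#|` B| <= Delta0)%N.
Proof.
rewrite /bounded_subsets; case: ifP => [AD|_]; first by rewrite inE => /eqP ->.
by rewrite mem_filter => /andP[/eqP ->].
Qed.

Lemma bounded_subsets_gt0 Delta0 A : (0 < size (bounded_subsets Delta0 A))%N.
Proof.
rewrite /bounded_subsets; case: ifPn => // AD; rewrite -ltnNge in AD.
pose B := [fset i in take Delta0 A].
have BA : B `<=` A by apply/fsubsetP => i; rewrite inE /= => /mem_take.
have Bc : #|` B| == Delta0.
  by rewrite card_fseq undup_id ?take_uniq ?fset_uniq// size_take AD.
rewrite lt0n; apply/eqP => /size0nil/(congr1 (fun s => B \in s)).
by rewrite mem_filter Bc fpowersetE BA.
Qed.

Lemma mean_bounded_datasets_cons Delta0 A S (F : dataset Sigma -> R) :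
  mean (bounded_datasets Delta0 (A :: S)) F =
  mean (bounded_subsets Delta0 A)
    (fun B => mean (bounded_datasets Delta0 S) (fun T => F (B :: T))).
Proof.
rewrite /mean /= size_allpairs natrM invfM -mulrA; congr (_ * _).
by rewrite big_allpairs_dep -mulr_sumr.
Qed.

Lemma bounded_datasets_gt0 Delta0 S : (0 < size (bounded_datasets Delta0 S))%N.
Proof. by elim: S => //= A S IH; rewrite size_allpairs muln_gt0 bounded_subsets_gt0. Qed.

Lemma mean_in_affine (J : eqType) (s : seq J) (F G : J -> R) (c1 c2 delta : R) :
  (0 < size s)%N -> {in s, forall j, c1 * F j <= c2 * G j + delta} ->
  c1 * mean s F <= c2 * mean s G + delta.
Proof.
move=> s0 FG; have s0' : 0 < (size s)%:R :> R by rewrite ltr0n.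
have -> : delta = (size s)%:R^-1 * \sum_(j <- s) delta.
  by rewrite big_const_seq count_predT iter_addr_0 -(mulr_natl delta) mulKf ?gt_eqF.
rewrite /mean mulrCA (mulrCA c2) -mulrDr; apply: ler_wpM2l; first by rewrite invr_ge0 ltW.
rewrite !mulr_sumr -big_split/= big_seq [leRHS]big_seq.
by apply: ler_sum => j; exact: FG.
Qed.

Lemma mean_cst (J : Type) (s : seq J) (c : R) : (0 < size s)%N -> mean s (fun=> c) = c.
Proof.
move=> s0; rewrite /mean big_const_seq count_predT iter_addr_0 -(mulr_natl c) mulKf//.
by rewrite pnatr_eq0 -lt0n.
Qed.

(* Used with [(c1, c2) = (1, expR eps)] and [(c1, c2) = (- expR eps, -1)], which are
   the two directions of neighboring datasets. *)
Lemma mean_bounded_datasets_insert Delta0 A S1 S2 (F G : dataset Sigma -> R) (c1 c2 delta : R) :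
  (forall T1 T2 B, (#|` B| <= Delta0)%N ->
    c1 * F (T1 ++ B :: T2) <= c2 * G (T1 ++ T2) + delta) ->
  c1 * mean (bounded_datasets Delta0 (S1 ++ A :: S2)) F <=
  c2 * mean (bounded_datasets Delta0 (S1 ++ S2)) G + delta.
Proof.
elim: S1 F G => [|A1 S1 IH] F G FG.
  rewrite !cat0s mean_bounded_datasets_cons.
  (* Viewed as the mean of a constant over the choices for [A], the right side can be compared
     choice by choice. *)
  rewrite -(mean_cst (mean _ G) (bounded_subsets_gt0 Delta0 A)).
  apply: mean_in_affine => [|B BA]; first exact: bounded_subsets_gt0.
  apply: mean_in_affine => [|T _]; first exact: bounded_datasets_gt0.
  by have := FG [::] T B (bounded_subsets_card BA).
rewrite !cat_cons !mean_bounded_datasets_cons.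
apply: mean_in_affine => [|B BA1]; first exact: bounded_subsets_gt0.
apply: IH => T1 T2 B' B'D.
by have := FG (B :: T1) T2 B' B'D.
Qed.

End average.

(** * Privacy of the whole mechanism *)

Section privacy.
Context {Sigma : choiceType} {R : realType}.
Local Open Scope fset_scope.
Local Open Scope ring_scope.
Local Notation X := (measurableTypeR R).
Local Notation N s := (normal_prob (0 : R) s).
Implicit Types (S T : dataset Sigma) (A B : {fset Sigma}).

(** Round 2 depends on its noise only through finitely many comparisons, so its events are
    measurable however wild [O] is. *)
Lemma measurable_comparisons n (U V : seq Sigma) (m : Sigma -> R) (rho : R) (Q : seq bool -> Prop) :
  measurable [set z : n.-tuple X | Q [seq rho <= m i + noise (0 : X) U z i | i <- V]]%classic.
Proof.
elim: V Q => [|i V IH] Q /=.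
  have [q|nq] := pselect (Q [::]).
    by rewrite (_ : mkset _ = setT)//; apply/seteqP; split.
  by rewrite (_ : mkset _ = set0)//; apply/seteqP; split.
pose H := [set z : n.-tuple X | rho <= m i + noise (0 : X) U z i]%classic.
have mH : measurable H.
  have -> : H = ((fun z : n.-tuple X => noise (0 : X) U z i : X) @^-1` `[rho - m i, +oo[)%classic.
    by apply/seteqP; split => z /=; rewrite /H/= in_itv/= andbT lerBlDl.
  rewrite -[X in measurable X]setTI.
  by apply: measurable_noise => //; exact: measurable_itv.
pose E b := [set z : n.-tuple X | Q (b :: [seq rho <= m i + noise (0 : X) U z i | i <- V])]%classic.
have mE b : measurable (E b) := IH (fun s => Q (b :: s)).
rewrite (_ : mkset _ = (H `&` E true) `|` (~` H `&` E false))%classic.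
  by apply: measurableU; apply: measurableI => //; exact: measurableC.
apply/seteqP; split => z /=; rewrite /H /E/=.
  by case: (boolP (rho <= _)) => h q; [left|right]; split=> //; exact/negP.
by case => -[h]; [rewrite h|move/negP/negbTE: h => ->].
Qed.

Section fixed_parameters.
Variables (delta1 delta2 : R) (Delta0 : nat).
Variables (dmax beta Clb Cub bmin bmax sigma1 sigma2 : R).
Variable O : set {fset Sigma}.

Let rho1 := threshold 1 sigma1 delta1 Delta0.
Let rho2 := threshold bmax sigma2 delta2 Delta0.
Let output := @mad2r_output Sigma R delta1 delta2 Delta0 dmax beta Clb Cub bmin bmax sigma1 sigma2.
Let second W S := @prob2 Sigma R rho1 rho2 (rho2 + beta * sigma2) dmax Clb Cub bmin bmax
  sigma1 sigma2 O S W.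

Definition mad2r_prob S : \bar R :=
  let n := #|` universe S| in
  (iid (N sigma1) n \x iid (N sigma2) n)%E
    [set z : n.-tuple R * n.-tuple R | O (output S z.1 z.2)]%classic.

(** The product measure is by definition the integral over [z1] of the measures of the sections.
    Each section is measurable in [z2], which turns its measure into an integral. *)
Lemma mad2r_probE S : mad2r_prob S = noise_integral (N sigma1) (0 : X) (universe S)
  (fun x => second (fun i => mad S (rho1 + beta * sigma1) dmax (fun=> 1) 1 1 i + x i) S).
Proof.
rewrite /mad2r_prob /product_measure1 /noise_integral; apply: eq_integral => z1 _ /=.
pose W i := mad S (rho1 + beta * sigma1) dmax (fun=> 1) 1 1 i + noise (0 : X) (universe S) z1 i.
pose V := universe (dataset2 rho1 rho2 Cub sigma1 S W).
pose m := mad2 rho1 rho2 (rho2 + beta * sigma2) dmax Clb Cub bmin bmax sigma1 S W.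
pose Y (z2 : (size (universe S)).-tuple X) :=
  above1 rho1 S W `|` [fset i in V | rho2 <= m i + noise (0 : X) (universe S) z2 i].
pose E := [set z2 | O (Y z2)]%classic.
have mE : measurable E.
  have := @measurable_comparisons (size (universe S)) (universe S) V m rho2
    (fun s => O (above1 rho1 S W `|` [fset i in V | nth false s (index i V)])).
  congr (measurable _); apply/seteqP; split => z2; rewrite /E /Y /=;
    congr (O (_ `|` _)); apply/fsetP => i; rewrite !inE/=;
    case: (boolP (i \in V)) => //= iV;
    by rewrite (nth_map i) ?index_mem// nth_index.
transitivity (iid (N sigma2) (size (universe S)) E).
  by congr (iid _ _ _); apply/seteqP; split => z2; rewrite /xsection/= inE.
transitivity (\int[iid (N sigma2) (size (universe S))]_z2 (\1_E z2)%:E)%E.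
  by apply: esym; apply: etrans (integral_indic _ measurableT mE) _; rewrite setIT.
by apply: eq_integral => z2 _; rewrite /event indicE.
Qed.

(** This allows the additional user to be moved to the front of the dataset. *)
Lemma mad2r_prob_perm S S' : perm_eq S S' -> mad2r_prob S = mad2r_prob S'.
Proof.
move=> SS'; rewrite !mad2r_probE.
have uE : universe S = universe S' by exact: perm_big.
rewrite uE (mad_perm _ _ _ _ _ SS'); congr (noise_integral _ _ _ _).
apply/funext => x; rewrite /second; set W := fun i => _.
have aE : above1 rho1 S W = above1 rho1 S' W by rewrite /above1 uE.
have dE : perm_eq (dataset2 rho1 rho2 Cub sigma1 S W) (dataset2 rho1 rho2 Cub sigma1 S' W).
  by rewrite /dataset2 aE /below2 uE perm_map.
have udE : universe (dataset2 rho1 rho2 Cub sigma1 S W) =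
    universe (dataset2 rho1 rho2 Cub sigma1 S' W) by exact: perm_big.
rewrite /prob2 uE; congr (noise_integral _ _ _ _); apply/funext => y.
by rewrite /output2 aE udE /mad2 (mad_perm _ _ _ _ _ dE).
Qed.

Lemma mad2r_prob01 S : (0 <= mad2r_prob S <= 1)%E.
Proof.
rewrite mad2r_probE; apply/andP; split.
  apply: integral_ge0 => z _.
  by have /andP[] := prob2_01 rho1 rho2 (rho2 + beta * sigma2) dmax Clb Cub bmin bmax sigma1 sigma2 O S
    (fun i => mad S (rho1 + beta * sigma1) dmax (fun=> 1) 1 1 i + noise (0 : X) (universe S) z i).
rewrite -[leRHS](integral_prob_cst (iid (N sigma1) (size (universe S)))).
apply: ge0_le_lower_integral => z;
  by have /andP[] := prob2_01 rho1 rho2 (rho2 + beta * sigma2) dmax Clb Cub bmin bmax sigma1 sigma2 O S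
    (fun i => mad S (rho1 + beta * sigma1) dmax (fun=> 1) 1 1 i + noise (0 : X) (universe S) z i).
Qed.

Lemma mad2rE S : mad2r delta1 delta2 Delta0 dmax beta Clb Cub bmin bmax sigma1 sigma2 S O =
  (mean (bounded_datasets Delta0 S) (fun T => fine (mad2r_prob T)))%:E.
Proof.
rewrite /mad2r /mean EFinM -sumEFin; congr (_ * _)%E; apply: eq_bigr => T _.
rewrite fineK//; have /andP[p0 p1] := mad2r_prob01 T.
by rewrite ge0_fin_numE// (le_lt_trans p1)// ltry.
Qed.

Lemma mad2r_prob_dp (eps1 eps2 : R) A S :
  0 < delta1 < 1 -> 0 < delta2 < 1 -> (0 < Delta0)%N -> 1 < dmax -> 0 <= beta ->
  1 / 2 <= bmin -> bmin <= 1 -> 1 <= bmax ->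
  gaussian_noise_level eps1 (delta1 / 2) sigma1 ->
  gaussian_noise_level eps2 (delta2 / 2) sigma2 ->
  (#|` A| <= Delta0)%N ->
  (mad2r_prob (A :: S) <= (expR (eps1 + eps2))%:E * mad2r_prob S + (delta1 + delta2)%:E)%E /\
  (mad2r_prob S <= (expR (eps1 + eps2))%:E * mad2r_prob (A :: S) + (delta1 + delta2)%:E)%E.
Proof.
move=> d1 d2 D0 dmax1 beta0 bmin_ge bmin1 bmax1 nl1 nl2 AD.
have s1 : 0 < sigma1 := nl1.1.
have s2 : 0 < sigma2 := nl2.1.
have r1 : 1 <= rho1 by exact: threshold_ge.
have r2 : 1 <= rho2 by apply: le_trans bmax1 _; exact: threshold_ge.
have tau1 : 1 <= rho1 + beta * sigma1 by rewrite ler_wpDr// mulr_ge0// ltW.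
have tau2 : 1 <= rho2 + beta * sigma2 by rewrite ler_wpDr// mulr_ge0// ltW.
have half1 : 1 / 2 <= 1 :> R by lra.
have US : {subset (universe S : seq Sigma) <= (universe (A :: S) : seq Sigma)}.
  by apply/fsubsetP; rewrite universe_cons fsubsetUr.
rewrite (mad2r_probE (A :: S)).
pose F x := second (fun i => mad S (rho1 + beta * sigma1) dmax (fun=> 1) 1 1 i + x i) S.
have F0 x : (0 <= F x)%E.
  by have /andP[] := prob2_01 rho1 rho2 (rho2 + beta * sigma2) dmax Clb Cub bmin bmax sigma1 sigma2 O S
      (fun i => mad S (rho1 + beta * sigma1) dmax (fun=> 1) 1 1 i + x i).
have dF : depends_on (mem (universe S)) F.
  by move=> x y xy; apply: prob2_depends => i /xy ->.
have -> : mad2r_prob S = noise_integral (N sigma1) (0 : X) (universe (A :: S)) F.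
  rewrite (mad2r_probE S); apply: esym.
  exact: (@noise_integral_sub _ _ _ _ _ (0 : X) _ _ F).
have := @mad_round Sigma R sigma1 eps1 delta1 eps2 delta2 Delta0 (rho1 + beta * sigma1) dmax
  (fun=> 1) 1 1 A S (fun W => second W (A :: S)) (fun W => second W S)
  nl1 d1 tau1 dmax1 half1 (lexx _) (lexx _) AD.
apply.
- by move=> W; exact: prob2_01.
- by move=> W; exact: prob2_01.
- exact: prob2_depends.
- exact: (depends_onS US (@prob2_depends _ _ _ _ _ _ _ _ _ _ _ _ _ S)).
- by have /andP[/ltW] := d2.
- by move=> W good; apply: (prob2_dp Clb Cub sigma1 O tau2 dmax1 bmin_ge bmin1 bmax1 nl2 d2 erefl AD good).
Qed.

End fixed_parameters.
End privacy.

Theorem theorem10 (R : realType) (Sigma : choiceType)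
    (eps1 eps2 delta1 delta2 : R) (Delta0 : nat)
    (dmax beta Clb Cub bmin bmax sigma1 sigma2 : R)
    (eps1_gt0 : 0 < eps1) (eps2_gt0 : 0 < eps2)
    (delta1_gt0 : 0 < delta1) (delta1_lt1 : delta1 < 1)
    (delta2_gt0 : 0 < delta2) (delta2_lt1 : delta2 < 1)
    (Delta0_gt0 : (0 < Delta0)%N) (dmax_gt1 : 1 < dmax) (beta_ge0 : 0 <= beta)
    (Clb_ge0 : 0 <= Clb) (Cub_ge0 : 0 <= Cub)
    (bmin_ge : 1 / 2 <= bmin) (bmin_le1 : bmin <= 1) (bmax_ge1 : 1 <= bmax)
    (sigma1P : gaussian_noise_level eps1 (delta1 / 2) sigma1)
    (sigma2P : gaussian_noise_level eps2 (delta2 / 2) sigma2) :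
  differentially_private
    (mad2r (Sigma := Sigma) delta1 delta2 Delta0
       dmax beta Clb Cub bmin bmax sigma1 sigma2)
    (eps1 + eps2) (delta1 + delta2).
Proof.
move=> S S' SS' O; set M := mad2r _ _ _ _ _ _ _ _ _ _ _.
pose p T := mad2r_prob delta1 delta2 Delta0 dmax beta Clb Cub bmin bmax sigma1 sigma2 O T.
have ME T : M T O = (mean (bounded_datasets Delta0 T) (fine \o p))%:E by exact: mad2rE.
have pfin T : p T \is a fin_num.
  have /andP[p0 p1] := mad2r_prob01 delta1 delta2 Delta0 dmax beta Clb Cub bmin bmax sigma1 sigma2 O T.
  by rewrite ge0_fin_numE// (le_lt_trans p1)// ltry.
have pdp T1 T2 (B : {fset Sigma}) : (#|` B| <= Delta0)%N ->
    (p (T1 ++ B :: T2) <= (expR (eps1 + eps2))%:E * p (T1 ++ T2) + (delta1 + delta2)%:E)%E /\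
    (p (T1 ++ T2) <= (expR (eps1 + eps2))%:E * p (T1 ++ B :: T2) + (delta1 + delta2)%:E)%E.
  have -> : p (T1 ++ B :: T2) = p (B :: (T1 ++ T2)).
    by apply: mad2r_prob_perm; rewrite (perm_catCA T1 [:: B] T2).
  by apply: mad2r_prob_dp => //; apply/andP.
rewrite !ME -EFinM -EFinD lee_fin.
case: SS' => [[S1 [S2 [A [-> ->]]]]|[S1 [S2 [A [-> ->]]]]].
  suff: - expR (eps1 + eps2) * mean (bounded_datasets Delta0 (S1 ++ A :: S2)) (fine \o p) <=
      -1 * mean (bounded_datasets Delta0 (S1 ++ S2)) (fine \o p) + (delta1 + delta2) by lra.
  apply: mean_bounded_datasets_insert => T1 T2 B /(pdp T1 T2)[_].
  by rewrite -(fineK (pfin (T1 ++ T2))) -(fineK (pfin (T1 ++ B :: T2))) -EFinM -EFinD lee_fin /=; lra.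
rewrite -[leLHS]mul1r; apply: mean_bounded_datasets_insert => T1 T2 B /(pdp T1 T2)[+ _].
by rewrite -(fineK (pfin (T1 ++ T2))) -(fineK (pfin (T1 ++ B :: T2))) -EFinM -EFinD lee_fin mul1r.
Qed.
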